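(* Fix an integer $k\ge 1$, and let the problem be either Max-$k$XOR (with $\mu=\tfrac12$) or Max-$k$SAT (with $\mu=1-2^{-k}$). There are constants $c,C>0$, depending only on $k$, and a polynomial-time quantum algorithm such that the following holds for all integers $D,m,n\ge 1$. Let $\mathcal S_1,\dots,\mathcal S_m$ be any $k$-tuples of distinct variables from $x_1,\dots,x_n$, pairwise distinct as sets, such that each variable occurs in at most $D$ of them, and construct an instance by placing on each $\mathcal S_l$ one constraint whose signs are chosen uniformly at random and independently. Then for typical instances the quantum algorithm, given the instance, finds an assignment satisfying a $\mu+\Omega(1/\sqrt D)$ fraction of the constraints; that is, with probability at least $1-C\,D^3/m$ over the random signs, it finds an assignment $x\in\{-1,1\}^n$ satisfying at least a $\mu+c/\sqrt D$ fraction of the $m$ constraints.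
   Context: Variables take values in $\{-1,1\}$. A $k$XOR constraint on the scope $(x_{i_1},\dots,x_{i_k})$ is a predicate of the form $\frac12\pm\frac12\prod_{j=1}^k x_{i_j}$ (one random sign per constraint). A $k$SAT constraint on this scope is a predicate of the form $1-\prod_{j=1}^k\frac{1\pm x_{i_j}}{2}$ ($k$ random signs per constraint, independent). A constraint is satisfied by an assignment if its predicate equals $1$. The number $\mu$ is the expected fraction of constraints satisfied by a uniformly random assignment. A polynomial-time quantum algorithm ''finds'' an assignment with a given property on an instance if, run on that instance, it outputs such an assignment with probability at least $2/3$ over its own measurement randomness, in time polynomial in the instance size. *)

(* Defs.v *)
From mathcomp Require Import all_boot all_order all_algebra.
From mathcomp Require Import boolp reals.
From mathcomp Require Import complex.

Set Implicit Arguments.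
Unset Strict Implicit.
Unset Printing Implicit Defensive.

Import Order.TTheory GRing.Theory Num.Theory.
Local Open Scope ring_scope.

(** * Constraint satisfaction problems *)

Inductive problem := MaxXOR | MaxSAT.

(* An XOR constraint carries a single sign, a SAT constraint one per literal. *)
Definition nsigns (pb : problem) (k : nat) : nat :=
  match pb with MaxXOR => 1%N | MaxSAT => k end.

Definition signs (pb : problem) (k : nat) := {ffun 'I_(nsigns pb k) -> bool}.

(* A bit b stands for the sign (or the variable value) (-1)^b. *)
Definition assignment (n : nat) := {ffun 'I_n -> bool}.

Definition pm (b : bool) : rat := (-1) ^+ b.

Definition predicate (pb : problem) (k n : nat) :
    signs pb k -> k.-tuple 'I_n -> assignment n -> rat :=
  match pb return signs pb k -> k.-tuple 'I_n -> assignment n -> rat with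
  | MaxXOR => fun s S x =>
      1 / 2%:R + pm (s ord0) * (1 / 2%:R) * \prod_(j < k) pm (x (tnth S j))
  | MaxSAT => fun s S x =>
      1 - \prod_(j < k) ((1 + pm (s j) * pm (x (tnth S j))) / 2%:R)
  end.

Record instance (pb : problem) (k : nat) := Instance {
  nvars : nat;
  nconstrs : nat;
  scope : 'I_nconstrs -> k.-tuple 'I_nvars;
  sign : 'I_nconstrs -> signs pb k
}.
Arguments Instance {pb k nvars nconstrs}.
Arguments scope {pb k} i.
Arguments sign {pb k} i.

Definition sat_fraction (R : realType) pb k (I : instance pb k)
    (x : assignment (nvars I)) : R :=
  #|[set l : 'I_(nconstrs I) | predicate (sign I l) (scope I l) x == 1]|%:R
    / (nconstrs I)%:R.
Arguments sat_fraction R {pb k} I x.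

(* The expected fraction of constraints satisfied by a uniform assignment. *)
Definition mu (R : realType) (pb : problem) (k : nat) : R :=
  match pb with MaxXOR => 1 / 2%:R | MaxSAT => 1 - 2%:R ^- k end.

(* Uniform probability of an event on a finite type; on the product type
   {ffun 'I_m -> signs pb k} this makes all the signs independent and
   unbiased. *)
Definition unif_prob (R : realType) (T : finType) (E : T -> Prop) : R :=
  #|[set t : T | `[< E t >]]|%:R / #|T|%:R.

(** * Words over {0,1} *)

Definition unary (s : seq nat) : seq bool :=
  flatten [seq rcons (nseq i true) false | i <- s].

(* Unary numerals change the size of the input only polynomially: an output
   on n variables has n bits, so n counts as part of the instance size, and
   all the indices are below n. *)
Definition instance_word pb k (I : instance pb k) : seq bool :=
  unary [:: nvars I, nconstrs I &
    flatten [seq [seq nat_of_bool (sign I l j) | j <- enum 'I_(nsigns pb k)]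
                 ++ [seq nat_of_ord i | i <- scope I l]
            | l <- enum 'I_(nconstrs I)]].

(** * Deterministic multitape Turing machines *)

(* Tapes are infinite in both directions, with cells holding 0, 1 or a blank
   (None).  The transition table returns None to halt, and otherwise the new
   state and, for each tape, the symbol to write and the move of the head.
   There is an input tape (ord0), an output tape (ord_max) and any number of
   work tapes. *)
Inductive move := MoveLeft | Stay | MoveRight.

Record machine := Machine {
  nwork : nat;
  state : finType;
  start : state;
  delta : state -> {ffun 'I_nwork.+2 -> option bool} ->
          option (state * ('I_nwork.+2 -> option bool * move))
}.

Record config (M : machine) := Config {
  cstate : state M;
  head : 'I_(nwork M).+2 -> int;
  tape : 'I_(nwork M).+2 -> int -> option bool
}.

Definition tape_of_word (w : seq bool) (p : int) : option bool :=
  match p with Posz i => onth w i | Negz _ => None end.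

Definition init_config (M : machine) (w : seq bool) : config M :=
  Config (start M) (fun=> 0)
         (fun i => if i == ord0 then tape_of_word w else fun=> None).

Definition shift (d : move) (p : int) : int :=
  match d with MoveLeft => p - 1 | Stay => p | MoveRight => p + 1 end.

Definition transition (M : machine) (c : config M) :=
  delta (cstate c) [ffun i => tape c i (head c i)].

Definition step (M : machine) (c : config M) : config M :=
  if transition c is Some (q, act) then
    Config q (fun i => shift (act i).2 (head c i))
             (fun i => [eta tape c i with head c i |-> (act i).1])
  else c.

Definition computes_in (M : machine) (t : nat) (w v : seq bool) : Prop :=
  let c := iter t (@step M) (init_config M w) in
  transition c = None /\ tape c ord_max =1 tape_of_word v.

(** * Quantum circuits *)

(* The universal gate set {H, T, CNOT}. *)
Inductive gate (N : nat) :=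
  | GateH of 'I_N
  | GateT of 'I_N
  | GateCNOT (control target : 'I_N) of control != target.

Definition circuit (N : nat) := seq (gate N).

Definition basis (N : nat) := {ffun 'I_N -> bool}.

Definition set_bit N (x : basis N) (i : 'I_N) (b : bool) : basis N :=
  [ffun j => if j == i then b else x j].

Section Semantics.
Variable C : numClosedFieldType.

(* A state of N qubits is its family of amplitudes in the standard basis. *)
Definition qstate (N : nat) := basis N -> C.

Definition apply1 (U : bool -> bool -> C) N (i : 'I_N) (psi : qstate N) :
    qstate N :=
  fun x => \sum_(b : bool) U (x i) b * psi (set_bit x i b).

Definition hadamard (a b : bool) : C := (-1) ^+ (a && b) / sqrtC 2%:R.

Definition tphase (a b : bool) : C :=
  if a != b then 0 else if a then (1 + 'i) / sqrtC 2%:R else 1.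

Definition apply_gate N (g : gate N) (psi : qstate N) : qstate N :=
  match g with
  | GateH i => apply1 hadamard i psi
  | GateT i => apply1 tphase i psi
  | GateCNOT i j _ => fun x => psi (set_bit x j (x i (+) x j))
  end.

(* The gates are applied from left to right to |0...0>. *)
Definition run_circuit N (c : circuit N) : qstate N :=
  foldl (fun psi g => apply_gate g psi)
        (fun x => (x == [ffun=> false])%:R) c.

(* Born rule: the probability that measuring all the qubits of the final state
   in the standard basis gives an outcome in P. *)
Definition measure_prob N (c : circuit N) (P : pred (basis N)) : C :=
  \sum_(x | P x) `|run_circuit c x| ^+ 2.

End Semantics.

Definition gate_code N (g : gate N) : seq nat :=
  match g with
  | GateH i => [:: 0%N; nat_of_ord i]
  | GateT i => [:: 1%N; nat_of_ord i]
  | GateCNOT i j _ => [:: 2%N; nat_of_ord i; nat_of_ord j]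
  end.

Definition circuit_word N (c : circuit N) : seq bool :=
  unary (N :: flatten [seq gate_code g | g <- c]).

Lemma unary_inj : injective unary.
Proof.
have cons_true i s : unary (i.+1 :: s) = true :: unary (i :: s) by [].
elim=> [|i s IHs] [|j t] //; first by case: j.
  by case: i.
elim: i j => [|i IHi] [|j] //; first by case=> /IHs->.
by rewrite !cons_true => -[/IHi [-> ->]].
Qed.

Lemma circuit_word_inj N : injective (@circuit_word N).
Proof.
move=> c d /unary_inj [].
elim: c d => [|g c IHc] [|h d] //; first by case: h.
  by case: g.
case: g => [i|i|i j ij]; case: h => [i'|i'|i' j' ij'] //=.
- by case=> /val_inj-> /IHc->.
- by case=> /val_inj-> /IHc->.
case=> /val_inj ei /val_inj ej /IHc->.
by case: _ / ei ij'; case: _ / ej => ij'; rewrite (bool_irrelevance ij ij').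
Qed.

(** * Quantum algorithms *)

(* As in Kitaev, Shen and Vyalyi, a quantum algorithm is a Turing machine that
   maps an instance to the description of a quantum circuit; the circuit is run
   on |0...0> and all the qubits are measured.  The first n qubits give the
   assignment and the others are ancillas; classical post-processing is part
   of the circuit. *)
Definition output_assignment n a (x : basis (n + a)) : assignment n :=
  [ffun i => x (lshift a i)].

Definition poly_time_quantum_algorithm (pb : problem) (k : nat) (M : machine) :
    Prop :=
  exists A d : nat, forall I : instance pb k,
    let w := instance_word I in
    exists (a : nat) (c : circuit (nvars I + a)) (t : nat),
      (t <= A * size w ^ d + A)%N /\ computes_in M t w (circuit_word c).

(* The circuit computed by M on I, which is unique since M is deterministic and
   descriptions are decodable, yields an assignment in P with probability at
   least 2/3. *)
Definition finds (R : realType) pb k (M : machine) (I : instance pb k)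
    (P : pred (assignment (nvars I))) : Prop :=
  exists (a : nat) (c : circuit (nvars I + a)) (t : nat),
    computes_in M t (instance_word I) (circuit_word c) /\
    2%:R / 3%:R <= measure_prob R[i] c [pred x | P (output_assignment x)].
Arguments finds R {pb k} M I P.

(* Main.v *)
Require Import Defs.
From mathcomp Require Import all_boot all_order all_algebra.
From mathcomp Require Import boolp reals.
From mathcomp Require Import complex zify ring lra.

Set Implicit Arguments.
Unset Strict Implicit.
Unset Printing Implicit Defensive.

Import Order.TTheory GRing.Theory Num.Theory.
Local Open Scope ring_scope.

(** A classical greedy algorithm suffices.  Give values to the variables in the
    order of their indices; x_i is chosen so as to violate as few as possible of
    the constraints whose last variable is x_i.  Twisting the signs of every
    constraint by the values of its earlier variables is a bijection of the sign
    vectors, and in terms of the twisted signs t, which are again uniform and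
    independent, the number of violated constraints is the sum over i of
    min(A_i, B_i), where A_i and B_i count the constraints with last variable x_i
    that the two values of x_i violate.  Since A_i - B_i is a sum of d_i <= D
    independent centred variables, E |A_i - B_i| is at least of the order of
    d_i / sqrt D, so that the mean is (1 - mu) m - Omega(m / sqrt D).  The
    summands are independent and bounded by D, so the variance is at most D m and
    Chebyshev's inequality gives the probability bound.

    The Turing machine runs the greedy algorithm and prints a circuit with no
    ancilla that applies X = H T^4 H to the qubits of the true variables. *)

(** * Programs with loops, compiled to Turing machines *)

(** The greedy values depend on the signs, so in the original signs the counts at [x_i] are
    entangled with the earlier choices. What unties them is that every choice can be computed from
    the twisted signs alone: this makes the twisting injective, hence a bijection of a finite set,
    and since a constraint has exactly one last variable the summands use disjoint sets of
    coordinates. Both problems fit one scheme: given values violate exactly one of the [N] sign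
    vectors, and changing the last value changes that vector, so a constraint is at stake with
    probability [p = 2/N], and [1 - mu = p/2]. The bound on [E |A_i - B_i|] needs only moments:
    [|z|] is bounded below by a combination of [z^2] and [z^4], and the fourth moment of a sum of
    [d] terms is at most [3 p d^2]. The mean gain is at least [p m / (4 sqrt D)], half of which is
    given up to the deviation. As [N <= 2^k], putting [2/2^k] for [p] yields constants that serve
    both problems. *)

Definition cells := (int * (int -> option bool))%type.

Definition read (c : cells) : option bool := c.2 c.1.

Definition put (b : option bool) (d : move) (c : cells) : cells :=
  (shift d c.1, fun p => if p == c.1 then b else c.2 p).

Lemma put_read d c : put (read c) d c = (shift d c.1, c.2).
Proof.
by congr pair; apply/funext => p /=; case: eqVneq => [->|].
Qed.

Lemma put_stay c : put (read c) Stay c = c.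
Proof. by rewrite put_read; case: c. Qed.

Lemma eq_Config (M : machine) (q : state M) h h' t t' :
  h =1 h' -> t =2 t' -> Config q h t = Config q h' t'.
Proof.
move=> /funext-> eq_t; congr Config.
by apply/funext => i; apply/funext => p; apply: eq_t.
Qed.

Section WhilePrograms.
Variables (nw : nat) (reg : finType).
Local Notation tid := 'I_nw.+2.
Local Notation tapes := (tid -> cells).
Local Notation mem := (reg * tapes)%type.

Definition set_tape (T : tapes) (i : tid) (c : cells) : tapes :=
  fun j => if j == i then c else T j.

(** Finite data sits in a register that becomes part of the machine state. As an operation touches a
    single tape, a loop test can rewrite the symbol that it reads and change nothing. *)
Inductive prog :=
  | Op of tid & (reg -> option bool -> reg * (option bool * move))
  | Seq of prog & prog
  | While of tid & (reg -> option bool -> bool) & prog.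

Fixpoint pc (p : prog) : finType :=
  match p with
  | Op _ _ => unit
  | Seq p q => (pc p + pc q)%type
  | While _ _ p => option (pc p)
  end.

Fixpoint entry (p : prog) : pc p :=
  match p return pc p with
  | Op _ _ => tt
  | Seq p q => inl (entry p)
  | While _ _ p => None
  end.

Definition effect := (reg * (tid * (option bool * move)))%type.

(* The next program point is None when control leaves the program. *)
Fixpoint pdelta (p : prog) : pc p -> reg -> (tid -> option bool) ->
    option (pc p) * effect :=
  match p return pc p -> reg -> (tid -> option bool) ->
    option (pc p) * effect with
  | Op i f => fun _ g r => let: (g', a) := f g (r i) in (None, (g', (i, a)))
  | Seq p q => fun s g r =>
      match s with
      | inl s => let: (o, e) := pdelta s g r in
                 (Some (if o is Some s' then inl s' else inr (entry q)), e)
      | inr s => let: (o, e) := pdelta s g r in (omap inr o, e)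
      end
  | While i b p => fun s g r =>
      match s with
      | None => (if b g (r i) then Some (Some (entry p)) else None,
                 (g, (i, (r i, Stay))))
      | Some s => let: (o, e) := pdelta s g r in (Some o, e)
      end
  end.

Definition run_effect (T : tapes) (e : effect) : mem :=
  let: (g, (i, (w, d))) := e in (g, set_tape T i (put w d (T i))).

(** Runs start at an arbitrary program point, so that the rules for sequences and loops follow by
    induction on the run; [exec] only bounds the time, so that estimates can be rounded up. *)
Inductive reach (p : prog) : pc p -> mem -> nat -> mem -> Prop :=
  | ReachExit s g T e :
      pdelta s g (read \o T) = (None, e) ->
      reach s (g, T) 1 (run_effect T e)
  | ReachStep s s' g T e t m :
      pdelta s g (read \o T) = (Some s', e) ->
      reach s' (run_effect T e) t m -> reach s (g, T) t.+1 m.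

Definition exec p t m m' := exists2 t', (t' <= t)%N & reach (entry p) m t' m'.

Lemma exec_le p t t' m m' : (t <= t')%N -> exec p t m m' -> exec p t' m m'.
Proof. by move=> le_t [u le_u ?]; exists u => //; apply: leq_trans le_t. Qed.

Lemma set_tape_id T i : set_tape T i (T i) = T.
Proof. by apply/funext => j; rewrite /set_tape; case: (eqVneq j i) => [->|]. Qed.

Lemma exec_op i f g T :
  let: (g', (w, d)) := f g (read (T i)) in
  exec (Op i f) 1 (g, T) (g', set_tape T i (put w d (T i))).
Proof.
case E: (f _ _) => [g' [w d]]; exists 1%N => //.
by apply: (@ReachExit (Op i f) tt g T (g', (i, (w, d)))); rewrite /= E.
Qed.

Lemma exec_seq p q t1 t2 m1 m2 m3 :
  exec p t1 m1 m2 -> exec q t2 m2 m3 -> exec (Seq p q) (t1 + t2) m1 m3.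
Proof.
move=> [u1 le1 H1] [u2 le2 H2]; exists (u1 + u2)%N; first exact: leq_add.
have Hq s m : reach s m u2 m3 -> @reach (Seq p q) (inr s) m u2 m3.
  elim=> [{}s g T e E|{}s s' g T e t m' E _ IH].
    by apply: ReachExit; rewrite /= E.
  by apply: (ReachStep _ IH); rewrite /= E.
rewrite /=; move: (entry p) H1 => s H1.
elim: H1 H2 => [{}s g T e E|{}s s' g T e t m' E _ IH] H2.
  by apply: (@ReachStep (Seq p q) _ (inr (entry q))); [rewrite /= E|apply: Hq].
by apply: (@ReachStep (Seq p q) _ (inl s')); [rewrite /= E|apply: IH].
Qed.

Lemma exec_while_exit i (b : reg -> option bool -> bool) p g T :
  ~~ b g (read (T i)) -> exec (While i b p) 1 (g, T) (g, T).
Proof.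
move=> nb; exists 1%N => //.
have E : run_effect T (g, (i, (read (T i), Stay))) = (g, T).
  by rewrite /= put_stay set_tape_id.
by rewrite -{2}E; apply: ReachExit; rewrite /= (negbTE nb).
Qed.

Lemma exec_while_loop i (b : reg -> option bool -> bool) p t1 t2 g T m2 m3 :
  b g (read (T i)) -> exec p t1 (g, T) m2 -> exec (While i b p) t2 m2 m3 ->
  exec (While i b p) (t1 + t2).+1 (g, T) m3.
Proof.
move=> bT [u1 le1 H1] [u2 le2 H2]; exists (u1 + u2).+1.
  by rewrite ltnS leq_add.
apply: (@ReachStep (While i b p) _ (Some (entry p)) _ _
          (g, (i, (read (T i), Stay)))); first by rewrite /= bT.
rewrite /= put_stay set_tape_id.
elim: H1 H2 => [s {}g {bT}T e E|s s' {}g {bT}T e t m' E _ IH] H2.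
  by apply: (ReachStep (e := e) _ H2); rewrite /= E.
by apply: (ReachStep (e := e) _ (IH H2)); rewrite /= E.
Qed.

(** * Translation of a program into a Turing machine *)

Variable (g0 : reg) (p : prog).

(** The control point [None] is the halting state. *)
Definition machine_of : machine :=
  @Machine nw (option (pc p) * reg)%type (Some (entry p), g0)
    (fun s r => if s.1 is Some s1 then
       let: (o, (g, (i, a))) := pdelta s1 s.2 r in
       Some ((o, g), fun j => if j == i then a else (r j, Stay))
     else None).

Definition config_of (s : option (pc p)) (m : mem) : config machine_of :=
  @Config machine_of (s, m.1) (fun i => (m.2 i).1) (fun i => (m.2 i).2).

Lemma step_config_of s g T o e : pdelta s g (read \o T) = (o, e) ->
  step (config_of (Some s) (g, T)) = config_of o (run_effect T e).
Proof.
case: e => g' [i [w d]] E.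
rewrite /step /transition /=.
have -> : pdelta s g [ffun j => (T j).2 (T j).1] = (o, (g', (i, (w, d)))).
  by rewrite -E; congr pdelta; apply/funext => j; rewrite ffunE.
apply: eq_Config => j; rewrite /set_tape /=; case: (eqVneq j i) => [->|_] //=.
by move=> q; rewrite ffunE /=; case: (eqVneq q) => [->|].
Qed.

Lemma reach_steps s m t m' : reach s m t m' ->
  iter t (@step machine_of) (config_of (Some s) m) = config_of None m'.
Proof.
elim=> {s m t m'} [s g T e E|s s' g T e t m' E _ IH].
  by rewrite /= (step_config_of E).
by rewrite iterSr (step_config_of E).
Qed.

Lemma exec_computes w v t T :
  exec p t (g0, fun i => (0, if i == ord0 then tape_of_word w else fun=> None))
    T ->
  (T.2 ord_max).2 =1 tape_of_word v ->
  exists2 t', (t' <= t)%N & computes_in machine_of t' w v.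
Proof.
move=> [t' le_t /reach_steps H] Tv; exists t' => //.
by rewrite /computes_in H.
Qed.

End WhilePrograms.

(** * The greedy algorithm on tapes *)

(** The head is on the first cell of [suf], or on the blank just after the word when [suf] is
    empty. *)
Definition zipper (pre suf : seq bool) : cells :=
  (Posz (size pre), tape_of_word (pre ++ suf)).

Definition leftend (s : seq bool) : cells := (-1, tape_of_word s).

Lemma read_zipper pre suf : read (zipper pre suf) = ohead suf.
Proof. by rewrite /read /= onth_cat ltnn subnn; case: suf. Qed.

Lemma read_leftend s : read (leftend s) = None.
Proof. by []. Qed.

Lemma write_word pre c suf b :
  (fun p => if p == Posz (size pre) then Some b
            else tape_of_word (pre ++ c :: suf) p)
  = tape_of_word (pre ++ b :: suf).
Proof.
apply/funext => -[p|p] //=; case: eqVneq => [[->]|ne_p].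
  by rewrite onth_cat ltnn subnn.
rewrite !onth_cat; case: ltnP => // le_p; case E: (p - size pre)%N => [|j] //.
by case/eqP: ne_p; congr Posz; lia.
Qed.

Lemma append_word s b :
  (fun p => if p == Posz (size s) then Some b else tape_of_word s p)
  = tape_of_word (rcons s b).
Proof.
apply/funext => -[p|p] //=; rewrite -cats1 onth_cat.
case: eqVneq => [[->]|ne_p]; first by rewrite ltnn subnn.
case: ltnP => // le_p; rewrite !onth_default //=.
by case E: (p - size s)%N => [|j] //; case/eqP: ne_p; congr Posz; lia.
Qed.

Lemma put_right pre c suf b :
  put (Some b) MoveRight (zipper pre (c :: suf)) = zipper (rcons pre b) suf.
Proof.
by rewrite /put /zipper /= write_word cat_rcons size_rcons -addn1 PoszD.
Qed.

Lemma put_right_end pre b :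
  put (Some b) MoveRight (zipper pre [::]) = zipper (rcons pre b) [::].
Proof.
by rewrite /put /zipper /= !cats0 append_word size_rcons -addn1 PoszD.
Qed.

Lemma put_here pre c suf b :
  put (Some b) Stay (zipper pre (c :: suf)) = zipper pre (b :: suf).
Proof. by rewrite /put /zipper /= write_word. Qed.

Lemma put_here_end pre b :
  put (Some b) Stay (zipper pre [::]) = zipper pre [:: b].
Proof. by rewrite /put /zipper /= cats0 append_word cats1. Qed.

Lemma put_left pre c suf :
  put (ohead suf) MoveLeft (zipper (rcons pre c) suf) = zipper pre (c :: suf).
Proof.
rewrite -{1}(read_zipper (rcons pre c)) put_read /zipper /=.
by rewrite cat_rcons size_rcons -addn1 PoszD addrK.
Qed.

Lemma put_left_end suf : put (ohead suf) MoveLeft (zipper [::] suf) = leftend suf.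
Proof. by rewrite -(read_zipper [::]) put_read. Qed.

Lemma put_leftend s : put None MoveRight (leftend s) = zipper [::] s.
Proof. by rewrite -(read_leftend s) put_read. Qed.

(* A stack of 1s on the cells base, ..., h - 1; the head is on the first free
   cell in stack and on the last used one in stack_top. *)
Definition stack_content (base h p : int) : option bool :=
  if base <= p < h then Some true else None.

Definition stack (base h : int) : cells := (h, stack_content base h).

Definition stack_top (base h : int) : cells := (h - 1, stack_content base h).

Lemma push_stack base h : base <= h ->
  put (Some true) MoveRight (stack base h) = stack base (h + 1).
Proof.
move=> le_h; congr pair; apply/funext => p /=; rewrite /stack_content.
by case: eqVneq => [->|ne_p]; [case: ifP|do 2!case: ifP] => //; lia.
Qed.

Lemma read_stack base h : read (stack base h) = None.
Proof. by rewrite /read /= /stack_content ltxx andbF. Qed.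

Lemma stack_to_top base h : put None MoveLeft (stack base h) = stack_top base h.
Proof. by rewrite -(read_stack base h) put_read. Qed.

Lemma pop_stack base h :
  put None MoveLeft (stack_top base h) = stack_top base (h - 1).
Proof.
congr pair; apply/funext => p /=; rewrite /stack_content.
by case: eqVneq => [->|ne_p]; [case: ifP|do 2!case: ifP] => //; lia.
Qed.

Lemma read_stack_top base h :
  read (stack_top base h) = if base < h then Some true else None.
Proof.
by rewrite /read /= /stack_content; do 2!case: ifP => //; lia.
Qed.

(** An emptied stack is a blank tape, and any position may serve as the base of a new one; hence the
    counter may drift along its tape from one variable to the next. *)
Lemma stack_empty base h : h <= base -> stack_top base h = stack (h - 1) (h - 1).
Proof.
move=> le_h; congr pair; apply/funext => p; rewrite /stack_content.
by do 2!case: ifP => //; lia.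
Qed.

(** The five tapes hold the instance, the values chosen so far, a unary copy of the number of
    variables that drives the outer loop, a counter, and the circuit being printed. *)
Definition tin : 'I_5 := @Ordinal 5 0 isT.
Definition tX : 'I_5 := @Ordinal 5 1 isT.
Definition tZ : 'I_5 := @Ordinal 5 2 isT.
Definition tC : 'I_5 := @Ordinal 5 3 isT.
Definition tout : 'I_5 := @Ordinal 5 4 isT.

Definition tapes5 (a b c d e : cells) : 'I_5 -> cells :=
  fun i => nth a [:: a; b; c; d; e] i.

Lemma set_tapes5 a b c d e x :
  (@set_tape 3 (tapes5 a b c d e) tin x = tapes5 x b c d e) *
  (@set_tape 3 (tapes5 a b c d e) tX x = tapes5 a x c d e) *
  (@set_tape 3 (tapes5 a b c d e) tZ x = tapes5 a b x d e) *
  (@set_tape 3 (tapes5 a b c d e) tC x = tapes5 a b c x e) *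
  (@set_tape 3 (tapes5 a b c d e) tout x = tapes5 a b c d x).
Proof. by do !split; apply/funext => -[[|[|[|[|[]]]]]]. Qed.

#[local] Arguments read : simpl never.
#[local] Arguments put : simpl never.
#[local] Arguments set_tape : simpl never.

(** * The greedy choices and the program that makes them *)

Section Program.
Variables (pb : problem) (k : nat).

Definition viol (s : signs pb k) (v : {ffun 'I_k -> bool}) : bool :=
  predicate s (ord_tuple k) v != 1.

(* A constraint counts as violated by a partial assignment only when all its
   variables have a value. *)
Definition pviol (s : signs pb k) (v : {ffun 'I_k -> option bool}) : bool :=
  [forall j, isSome (v j)] && viol s [ffun j => odflt false (v j)].

Definition prefix_values n (S : k.-tuple 'I_n) (xs : seq bool) :
  {ffun 'I_k -> option bool} := [ffun j => onth xs (tnth S j)].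

Definition nviol (I : instance pb k) (xs : seq bool) : nat :=
  count (fun l => pviol (sign I l) (prefix_values (scope I l) xs))
        (enum 'I_(nconstrs I)).

Definition best_value (I : instance pb k) (xs : seq bool) : bool :=
  (nviol I (rcons xs true) < nviol I (rcons xs false))%N.

Fixpoint greedy (I : instance pb k) (i : nat) : seq bool :=
  if i is j.+1 then rcons (greedy I j) (best_value I (greedy I j)) else [::].

(** The signs and the known values of the constraint being read, and a flag for the value just
    chosen, which tells whether gates must be printed. *)
Definition reg : finType :=
  (signs pb k * {ffun 'I_k -> option bool} * bool)%type.

Local Notation prog := (prog 3 reg).
Local Notation Op := (@Op 3 reg).
Local Notation While := (@While 3 reg).

Definition mv i d : prog := Op i (fun g r => (g, (r, d))).
Definition wr i b d : prog := Op i (fun g r => (g, (Some b, d))).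
Definition nonblank (g : reg) (r : option bool) : bool := r.
Definition one (g : reg) (r : option bool) : bool := r == Some true.

Definition skip : prog := Seq (While tin one (mv tin MoveRight)) (mv tin MoveRight).

Definition home i : prog :=
  Seq (mv i MoveLeft) (Seq (While i nonblank (mv i MoveLeft)) (mv i MoveRight)).

Definition to_last i : prog :=
  Seq (While i nonblank (mv i MoveRight)) (mv i MoveLeft).

Definition header : prog :=
  Seq (While tin one (Seq (mv tin MoveRight)
                          (Seq (wr tZ true MoveRight) (wr tout true MoveRight))))
      (Seq (wr tout false MoveRight) (Seq (home tin) (home tZ))).

Definition set_sign (j : 'I_(nsigns pb k)) (b : bool) (g : reg) : reg :=
  ([ffun i => if i == j then b else g.1.1 i], g.1.2, g.2).

Definition set_value (j : 'I_k) (b : option bool) (g : reg) : reg :=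
  (g.1.1, [ffun i => if i == j then b else g.1.2 i], g.2).

Definition read_sign (j : 'I_(nsigns pb k)) : prog :=
  Seq (Op tin (fun g r => (set_sign j (r == Some true) g, (r, Stay)))) skip.

(* The head of tX stops on the first blank, so the value read is onth xs i. *)
Definition read_var (j : 'I_k) : prog :=
  Seq (While tin one
         (Seq (mv tin MoveRight)
              (Op tX (fun g r => (g, (r, if r then MoveRight else Stay))))))
      (Seq (mv tin MoveRight)
           (Seq (Op tX (fun g r => (set_value j r g, (r, Stay)))) (home tX))).

(** The trial of [false] pushes a mark per violation and the trial of [true] erases one, so that a
    single counter compares the two counts. *)
Definition tally (b : bool) : prog :=
  Op tC (fun g r => (g, if pviol g.1.1 g.1.2
                        then if b then (None, MoveLeft) else (Some true, MoveRight)
                        else (r, Stay))).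

Definition read_vars (b : bool) (js : seq 'I_k) : prog :=
  foldr (fun j => Seq (read_var j)) (tally b) js.

Definition read_constr (b : bool) (js : seq 'I_(nsigns pb k)) : prog :=
  foldr (fun j => Seq (read_sign j)) (read_vars b (enum 'I_k)) js.

Definition pass (b : bool) : prog :=
  Seq skip (Seq skip
    (Seq (While tin nonblank (read_constr b (enum 'I_(nsigns pb k)))) (home tin))).

Definition trial (b : bool) : prog :=
  Seq (wr tX b Stay) (Seq (home tX) (Seq (pass b) (to_last tX))).

(** Marks are left exactly when [true] violates fewer constraints than [false]; they are erased for
    the next variable. *)
Definition decide : prog :=
  Seq (Op tC (fun g r => ((g.1, r == Some true), (r, Stay))))
  (Seq (Op tX (fun g r => (g, (Some g.2, Stay))))
       (While tC nonblank (Op tC (fun g r => (g, (None, MoveLeft)))))).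

(** The index of the current variable is the number of values to the left of the head of [tX], so
    walking over them prints it in unary. *)
Definition emit_var : prog :=
  Seq (Seq (mv tX MoveLeft)
           (While tX nonblank (Seq (wr tout true MoveRight) (mv tX MoveLeft))))
      (Seq (mv tX MoveRight) (Seq (wr tout false MoveRight) (to_last tX))).

Definition emit_gate (t : bool) : prog :=
  if t then Seq (wr tout true MoveRight) (Seq (wr tout false MoveRight) emit_var)
  else Seq (wr tout false MoveRight) emit_var.

(* H T^4 H is the gate X; H has code 0 and T has code 1. *)
Definition not_codes : seq bool := [:: false; true; true; true; true; false].

Definition emit_gates (ts : seq bool) : prog :=
  foldr (fun t => Seq (emit_gate t))
        (Op tC (fun g r => ((g.1, false), (r, Stay)))) ts.

(** A conditional in the form of a loop: the last operation of [emit_gates] clears the flag. *)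
Definition emit : prog := While tC (fun g _ => g.2) (emit_gates not_codes).

Definition next : prog := Seq (mv tX MoveRight) (mv tZ MoveRight).

Definition body : prog :=
  Seq (trial false) (Seq (mv tC MoveLeft)
    (Seq (trial true) (Seq decide (Seq emit next)))).

Definition main : prog := Seq header (While tZ nonblank body).

(** * Correctness and running time of the program *)

Lemma exec_op_to i f (g : reg) T g' w d T' :
  f g (read (T i)) = (g', (w, d)) -> set_tape T i (put w d (T i)) = T' ->
  exec (Op i f) 1 (g, T) (g', T').
Proof. by move=> E <-; have := exec_op i f g T; rewrite E. Qed.

Lemma exec_mv i d (g : reg) T T' :
  set_tape T i (put (read (T i)) d (T i)) = T' -> exec (mv i d) 1 (g, T) (g, T').
Proof. exact: exec_op_to. Qed.

Lemma exec_wr i b d (g : reg) T T' :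
  set_tape T i (put (Some b) d (T i)) = T' -> exec (wr i b d) 1 (g, T) (g, T').
Proof. exact: exec_op_to. Qed.

Lemma set_tapeK (T : 'I_5 -> cells) i c : @set_tape 3 T i c i = c.
Proof. by rewrite /set_tape eqxx. Qed.

Lemma set_set_tape (T : 'I_5 -> cells) i b c :
  @set_tape 3 (@set_tape 3 T i b) i c = @set_tape 3 T i c.
Proof. by apply/funext => j; rewrite /set_tape; case: eqP. Qed.

Definition num (j : nat) : seq bool := rcons (nseq j true) false.

Lemma exec_skip (g : reg) pre j suf x z c o :
  exec skip (2 * j + 2) (g, tapes5 (zipper pre (num j ++ suf)) x z c o)
    (g, tapes5 (zipper (pre ++ num j) suf) x z c o).
Proof.
have loop : exec (While tin one (mv tin MoveRight)) (2 * j + 1)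
    (g, tapes5 (zipper pre (num j ++ suf)) x z c o)
    (g, tapes5 (zipper (pre ++ nseq j true) (false :: suf)) x z c o).
  elim: j pre => [|j IH] pre.
    by rewrite cats0; apply: exec_while_exit; rewrite /= read_zipper.
  have H1 : exec (mv tin MoveRight) 1
      (g, tapes5 (zipper pre (num j.+1 ++ suf)) x z c o)
      (g, tapes5 (zipper (rcons pre true) (num j ++ suf)) x z c o).
    by apply: exec_mv; rewrite /= read_zipper put_right set_tapes5.
  have := IH (rcons pre true); rewrite cat_rcons => H2.
  by apply: exec_le (exec_while_loop _ H1 H2); [lia|rewrite /= read_zipper].
apply: exec_le (exec_seq loop _); last first.
  apply: exec_mv; rewrite /= read_zipper put_right set_tapes5.
  by rewrite -rcons_cat.
lia.
Qed.

(** The initial move brings a head that stood on the blank after the word back onto the word; from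
    the first cell it reaches the blank at cell -1 and the loop is empty. *)
Lemma exec_home i (g : reg) T pre suf : T i = zipper pre suf ->
  exec (home i) (2 * size pre + 3) (g, T)
    (g, set_tape T i (zipper [::] (pre ++ suf))).
Proof.
move=> Ti.
have loop u v T1 : T1 i = zipper u v -> ohead v ->
    exec (While i nonblank (mv i MoveLeft)) (2 * size u + 3)
      (g, T1) (g, set_tape T1 i (leftend (u ++ v))).
  elim/last_ind: u v T1 => [|u a IH] v T1 T1i v0.
    have H1 : exec (mv i MoveLeft) 1 (g, T1) (g, set_tape T1 i (leftend v)).
      by apply: exec_mv; rewrite T1i read_zipper put_left_end.
    have H2 : exec (While i nonblank (mv i MoveLeft)) 1
        (g, set_tape T1 i (leftend v)) (g, set_tape T1 i (leftend v)).
      by apply: exec_while_exit; rewrite set_tapeK.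
    by apply: exec_le (exec_while_loop _ H1 H2); rewrite // T1i read_zipper.
  have H1 : exec (mv i MoveLeft) 1 (g, T1) (g, set_tape T1 i (zipper u (a :: v))).
    by apply: exec_mv; rewrite T1i read_zipper put_left.
  have H2 := IH (a :: v) (set_tape T1 i (zipper u (a :: v))) (set_tapeK _ _ _) isT.
  rewrite set_set_tape -cat_rcons in H2.
  apply: exec_le (exec_while_loop _ H1 H2); rewrite ?size_rcons; first by lia.
  by rewrite T1i read_zipper.
have out s : exec (mv i MoveRight) 1 (g, set_tape T i (leftend s))
    (g, set_tape T i (zipper [::] s)).
  by apply: exec_mv; rewrite set_tapeK read_leftend put_leftend set_set_tape.
case/lastP: pre Ti => [|u a] Ti.
  have H1 : exec (mv i MoveLeft) 1 (g, T) (g, set_tape T i (leftend suf)).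
    by apply: exec_mv; rewrite Ti read_zipper put_left_end.
  have H2 : exec (While i nonblank (mv i MoveLeft)) 1
      (g, set_tape T i (leftend suf)) (g, set_tape T i (leftend suf)).
    by apply: exec_while_exit; rewrite set_tapeK.
  exact: exec_le (exec_seq H1 (exec_seq H2 (out _))).
have H1 : exec (mv i MoveLeft) 1 (g, T) (g, set_tape T i (zipper u (a :: suf))).
  by apply: exec_mv; rewrite Ti read_zipper put_left.
have H2 := loop u (a :: suf) (set_tape T i (zipper u (a :: suf)))
  (set_tapeK _ _ _) isT.
rewrite set_set_tape -cat_rcons in H2.
apply: exec_le (exec_seq H1 (exec_seq H2 (out _))).
by rewrite size_rcons; lia.
Qed.

Lemma exec_to_last i (g : reg) T pre suf s b :
  T i = zipper pre suf -> pre ++ suf = rcons s b ->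
  exec (to_last i) (2 * size suf + 2) (g, T)
    (g, set_tape T i (zipper s [:: b])).
Proof.
move=> Ti E.
have loop : exec (While i nonblank (mv i MoveRight)) (2 * size suf + 1)
    (g, T) (g, set_tape T i (zipper (rcons s b) [::])).
  rewrite -E {s b E}; elim: suf pre T Ti => [|a suf IH] pre T Ti.
    rewrite cats0 -Ti set_tape_id; apply: exec_while_exit.
    by rewrite Ti read_zipper.
  have H1 : exec (mv i MoveRight) 1 (g, T)
      (g, set_tape T i (zipper (rcons pre a) suf)).
    by apply: exec_mv; rewrite Ti read_zipper put_right.
  have H2 := IH (rcons pre a) (set_tape T i (zipper (rcons pre a) suf))
    (set_tapeK _ _ _).
  rewrite set_set_tape cat_rcons in H2.
  by apply: exec_le (exec_while_loop _ H1 H2); [move=> /=; lia|rewrite Ti read_zipper].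
apply: exec_le (exec_seq loop _); last first.
  apply: exec_mv.
  by rewrite set_tapeK read_zipper put_left set_set_tape.
lia.
Qed.

Lemma size_num j : size (num j) = j.+1.
Proof. by rewrite size_rcons size_nseq. Qed.

Lemma onth_drop (s : seq bool) i : onth s i = ohead (drop i s).
Proof. by elim: s i => [|a s IH] [|i] //=. Qed.

Lemma exec_read_sign (g : reg) j (b : bool) pre suf x z c o :
  exec (read_sign j) (6 * size (num b))
    (g, tapes5 (zipper pre (num b ++ suf)) x z c o)
    (set_sign j b g, tapes5 (zipper (pre ++ num b) suf) x z c o).
Proof.
rewrite size_num; set T := tapes5 _ x z c o.
have H1 : exec (Op tin (fun g r => (set_sign j (r == Some true) g, (r, Stay)))) 1
    (g, T) (set_sign j b g, T).
  have Tin : read (T tin) = Some b by rewrite read_zipper; case: b @T.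
  apply: exec_op_to; first by rewrite Tin; case: b {T Tin}.
  by rewrite -Tin put_stay set_tape_id.
by apply: exec_le (exec_seq H1 (exec_skip _ _ _ _ _ _ _ _)); case: b {T H1}.
Qed.

(** The head of [tX] advances by at most [i] cells, so rewinding it keeps the time linear in the
    length of the numeral, and a whole pass linear in the instance. *)
Lemma exec_read_var (g : reg) j i pre suf xs z c o :
  exec (read_var j) (6 * size (num i))
    (g, tapes5 (zipper pre (num i ++ suf)) (zipper [::] xs) z c o)
    (set_value j (onth xs i) g,
     tapes5 (zipper (pre ++ num i) suf) (zipper [::] xs) z c o).
Proof.
have loop u v : exec (While tin one
         (Seq (mv tin MoveRight)
              (Op tX (fun g r => (g, (r, if r then MoveRight else Stay))))))
    (3 * i + 1)
    (g, tapes5 (zipper pre (num i ++ suf)) (zipper u v) z c o)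
    (g, tapes5 (zipper (pre ++ nseq i true) (false :: suf))
               (zipper (u ++ take i v) (drop i v)) z c o).
  elim: i pre u v => [|i IH] pre u v.
    rewrite take0 drop0 !cats0; apply: exec_while_exit.
    by rewrite /= read_zipper.
  have H1 : exec (mv tin MoveRight) 1
      (g, tapes5 (zipper pre (num i.+1 ++ suf)) (zipper u v) z c o)
      (g, tapes5 (zipper (rcons pre true) (num i ++ suf)) (zipper u v) z c o).
    by apply: exec_mv; rewrite /= read_zipper put_right set_tapes5.
  have H2 : exec (Op tX (fun g r => (g, (r, if r then MoveRight else Stay)))) 1
      (g, tapes5 (zipper (rcons pre true) (num i ++ suf)) (zipper u v) z c o)
      (g, tapes5 (zipper (rcons pre true) (num i ++ suf))
                 (zipper (u ++ take 1 v) (drop 1 v)) z c o).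
    apply: exec_op_to; [reflexivity|rewrite set_tapes5; congr tapes5].
    case: v {H1} => [|a v]; rewrite /= read_zipper /=.
      by rewrite -[None]/(ohead (nil : seq bool)) -(read_zipper u) put_stay cats0.
    by rewrite put_right take0 drop0 cats1.
  have H3 := IH (rcons pre true) (u ++ take 1 v) (drop 1 v).
  rewrite cat_rcons -catA take_drop addn1 drop_drop addn1 in H3.
  have E : take 1 v ++ drop 1 (take i.+1 v) = take i.+1 v.
    by case: v {H1 H2 H3} => //= a v; rewrite take0 drop0.
  rewrite E in H3.
  apply: exec_le (exec_while_loop _ (exec_seq H1 H2) H3); first by lia.
  by rewrite /= read_zipper.
have H2 : exec (mv tin MoveRight) 1
    (g, tapes5 (zipper (pre ++ nseq i true) (false :: suf))
               (zipper (take i xs) (drop i xs)) z c o)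
    (g, tapes5 (zipper (pre ++ num i) suf)
               (zipper (take i xs) (drop i xs)) z c o).
  by apply: exec_mv; rewrite /= read_zipper put_right set_tapes5 -rcons_cat.
have H3 : exec (Op tX (fun g r => (set_value j r g, (r, Stay)))) 1
    (g, tapes5 (zipper (pre ++ num i) suf)
               (zipper (take i xs) (drop i xs)) z c o)
    (set_value j (onth xs i) g, tapes5 (zipper (pre ++ num i) suf)
               (zipper (take i xs) (drop i xs)) z c o).
  apply: exec_op_to; first by rewrite /= read_zipper -onth_drop.
  by rewrite onth_drop -(read_zipper (take i xs)) put_stay set_tapes5.
have := @exec_home tX (set_value j (onth xs i) g)
  (tapes5 (zipper (pre ++ num i) suf) (zipper (take i xs) (drop i xs)) z c o)
  _ _ erefl.
rewrite set_tapes5 cat_take_drop => H4.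
apply: exec_le (exec_seq (loop [::] xs) (exec_seq H2 (exec_seq H3 H4))).
by rewrite size_num size_take; case: ifP; lia.
Qed.

(** Here [v] is the number of violations seen in the current trial. In the second trial [h - v] may
    fall below [base]: erasing then walks over blanks, and the head ends on a blank, as it
    should. *)
Definition counter (b : bool) (base h : int) (v : nat) : cells :=
  if b then stack_top base (h - v%:Z) else stack base (h + v%:Z).

Lemma exec_tally (g : reg) b base h v a x z o : base <= h ->
  exec (tally b) 1
    (g, tapes5 a x z (counter b base h v) o)
    (g, tapes5 a x z (counter b base h (v + pviol g.1.1 g.1.2)) o).
Proof.
move=> le_h; set q := pviol _ _.
have := exec_op tC (fun g r => (g, if pviol g.1.1 g.1.2
                        then if b then (None, MoveLeft) else (Some true, MoveRight)
                        else (r, Stay))) g (tapes5 a x z (counter b base h v) o).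
rewrite -/q; case: q => /=; last by rewrite put_stay set_tapes5 addn0.
case: b => /=; rewrite set_tapes5; rewrite /counter.
  by rewrite pop_stack PoszD opprD addrA.
by rewrite push_stack ?PoszD ?addrA //; lia.
Qed.

Hypothesis k_gt0 : (0 < k)%N.
Implicit Types (g : reg) (base h : int).

Lemma unary_cat s t : unary (s ++ t) = unary s ++ unary t.
Proof. by rewrite /unary map_cat flatten_cat. Qed.

Lemma unary_cons j s : unary (j :: s) = num j ++ unary s.
Proof. by []. Qed.

Lemma exec_read_vars g js b base h v n (S : k.-tuple 'I_n) pre suf xs z o :
  base <= h ->
  let u := unary [seq val (tnth S j) | j <- js] in
  let g' := foldl (fun g j => set_value j (onth xs (tnth S j)) g) g js in
  exec (read_vars b js) (6 * size u + 1)
    (g, tapes5 (zipper pre (u ++ suf)) (zipper [::] xs) z (counter b base h v) o)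
    (g', tapes5 (zipper (pre ++ u) suf) (zipper [::] xs) z
                (counter b base h (v + pviol g'.1.1 g'.1.2)) o).
Proof.
move=> le_h; elim: js g pre => [|j js IH] g pre /=.
  by rewrite cats0; apply: exec_tally.
rewrite unary_cons -catA.
have H1 := exec_read_var g j (tnth S j) pre
  (unary [seq val (tnth S j) | j <- js] ++ suf) xs z (counter b base h v) o.
have := IH (set_value j (onth xs (tnth S j)) g) (pre ++ num (tnth S j)).
rewrite /= -catA => H2; apply: exec_le (exec_seq H1 H2).
by rewrite size_cat; lia.
Qed.

Lemma exec_read_constr g ss b base h v n (S : k.-tuple 'I_n) (s : signs pb k)
    pre suf xs z o :
  base <= h ->
  let u := unary ([seq nat_of_bool (s i) | i <- ss] ++
                  [seq val (tnth S j) | j <- enum 'I_k]) in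
  let g1 := foldl (fun g i => set_sign i (s i) g) g ss in
  let g' := foldl (fun g j => set_value j (onth xs (tnth S j)) g) g1 (enum 'I_k) in
  exec (read_constr b ss) (6 * size u + 1)
    (g, tapes5 (zipper pre (u ++ suf)) (zipper [::] xs) z (counter b base h v) o)
    (g', tapes5 (zipper (pre ++ u) suf) (zipper [::] xs) z
                (counter b base h (v + pviol g'.1.1 g'.1.2)) o).
Proof.
move=> le_h; elim: ss g pre => [|i js IH] g pre /=; first exact: exec_read_vars.
rewrite unary_cons -catA.
have H1 := exec_read_sign g i (s i) pre
  (unary ([seq nat_of_bool (s i) | i <- js] ++
          [seq val (tnth S j) | j <- enum 'I_k]) ++ suf)
  (zipper [::] xs) z (counter b base h v) o.
have := IH (set_sign i (s i) g) (pre ++ num (s i)).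
rewrite /= -catA => H2; apply: exec_le (exec_seq H1 H2).
by rewrite size_cat; lia.
Qed.

Lemma foldl_set_sign g (s : signs pb k) :
  foldl (fun g i => set_sign i (s i) g) g (enum 'I_(nsigns pb k)) =
  (s, g.1.2, g.2).
Proof.
have H ss : foldl (fun g i => set_sign i (s i) g) g ss =
    ([ffun i => if i \in ss then s i else g.1.1 i], g.1.2, g.2).
  elim/last_ind: ss => [|ss i IH] /=.
    by case: g => [[s0 w] f] /=; congr (_, _, _); apply/ffunP => i; rewrite ffunE.
  rewrite foldl_rcons IH /set_sign /=; congr (_, _, _); apply/ffunP => j.
  by rewrite !ffunE mem_rcons inE; case: eqP => [->|].
by rewrite H; congr (_, _, _); apply/ffunP => i; rewrite ffunE mem_enum.
Qed.

Lemma foldl_set_value g n (S : k.-tuple 'I_n) xs :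
  foldl (fun g j => set_value j (onth xs (tnth S j)) g) g (enum 'I_k) =
  (g.1.1, prefix_values S xs, g.2).
Proof.
have H js : foldl (fun g j => set_value j (onth xs (tnth S j)) g) g js =
    (g.1.1, [ffun j => if j \in js then onth xs (tnth S j) else g.1.2 j], g.2).
  elim/last_ind: js => [|js i IH] /=.
    by case: g => [[s0 w] f] /=; congr (_, _, _); apply/ffunP => i; rewrite ffunE.
  rewrite foldl_rcons IH /set_value /=; congr (_, _, _); apply/ffunP => j.
  by rewrite !ffunE mem_rcons inE; case: eqP => [->|].
by rewrite H; congr (_, _, _); apply/ffunP => i; rewrite !ffunE mem_enum.
Qed.

Definition constr_word (I : instance pb k) l : seq nat :=
  [seq nat_of_bool (sign I l j) | j <- enum 'I_(nsigns pb k)]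
    ++ [seq nat_of_ord i | i <- scope I l].

Lemma exec_constr g (I : instance pb k) l b base h v pre suf xs z o :
  base <= h ->
  let u := unary (@constr_word I l) in
  exec (read_constr b (enum 'I_(nsigns pb k))) (6 * size u + 1)
    (g, tapes5 (zipper pre (u ++ suf)) (zipper [::] xs) z (counter b base h v) o)
    (sign I l, prefix_values (scope I l) xs, g.2,
     tapes5 (zipper (pre ++ u) suf) (zipper [::] xs) z
       (counter b base h
          (v + pviol (sign I l) (prefix_values (scope I l) xs))) o).
Proof.
move=> le_h; have := exec_read_constr g (enum 'I_(nsigns pb k)) b v (scope I l) (sign I l)
  pre suf xs z o le_h.
cbv zeta; rewrite foldl_set_sign foldl_set_value /=.
suff -> : [seq val (tnth (scope I l) j) | j <- enum 'I_k] =
          [seq nat_of_ord i | i <- scope I l] by [].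
by rewrite -[in RHS](map_tnth_enum (scope I l)) -map_comp.
Qed.

(** Since [k] is positive a constraint fills at least one cell: a nonblank cell tells that a
    constraint remains, and the constant overhead of an iteration is absorbed in its length. *)
Lemma size_constr_word (I : instance pb k) l :
  (0 < size (unary (@constr_word I l)))%N.
Proof.
rewrite /constr_word unary_cat size_cat.
case: (scope I l) => -[|i s] /= => [/eqP|_]; first by lia.
by rewrite unary_cons size_cat size_num addnC.
Qed.

Lemma exec_constrs g (I : instance pb k) ls b base h v pre xs z o :
  base <= h ->
  let u := unary (flatten [seq @constr_word I l | l <- ls]) in
  exists2 g', g'.2 = g.2 &
  exec (While tin nonblank (read_constr b (enum 'I_(nsigns pb k))))
    (8 * size u + 1)
    (g, tapes5 (zipper pre u) (zipper [::] xs) z (counter b base h v) o)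
    (g', tapes5 (zipper (pre ++ u) [::]) (zipper [::] xs) z
       (counter b base h
          (v + count (fun l => pviol (sign I l) (prefix_values (scope I l) xs))
                     ls)) o).
Proof.
move=> le_h; elim: ls g v pre => [|l ls IH] g v pre /=.
  exists g => //; rewrite cats0 addn0; apply: exec_while_exit.
  by rewrite /= read_zipper.
rewrite unary_cat.
have H1 := exec_constr g l b v pre
  (unary (flatten [seq @constr_word I l | l <- ls])) xs z o le_h.
have [g' g'2 H2] := IH (sign I l, prefix_values (scope I l) xs, g.2)
  (v + pviol (sign I l) (prefix_values (scope I l) xs))%N
  (pre ++ unary (@constr_word I l)).
exists g' => //; rewrite -catA -addnA in H2.
have u_gt0 := size_constr_word l.
apply: exec_le (exec_while_loop _ H1 H2); first by rewrite size_cat; lia.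
by rewrite /= read_zipper; case: (unary _) u_gt0.
Qed.

Lemma instance_wordE (I : instance pb k) :
  instance_word I = num (nvars I) ++ num (nconstrs I) ++
    unary (flatten [seq @constr_word I l | l <- enum 'I_(nconstrs I)]).
Proof. by []. Qed.

Lemma exec_pass g (I : instance pb k) b base h xs z o :
  base <= h ->
  let w := instance_word I in
  exists2 g', g'.2 = g.2 &
  exec (pass b) (10 * size w + 10)
    (g, tapes5 (zipper [::] w) (zipper [::] xs) z (counter b base h 0) o)
    (g', tapes5 (zipper [::] w) (zipper [::] xs) z
       (counter b base h (nviol I xs)) o).
Proof.
move=> le_h; rewrite instance_wordE.
set n := nvars I; set m := nconstrs I; set u := unary _.
have H1 := exec_skip g [::] n (num m ++ u) (zipper [::] xs) z (counter b base h 0) o.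
have H2 := exec_skip g ([::] ++ num n) m u (zipper [::] xs) z (counter b base h 0) o.
have [g' g'2 H3] := exec_constrs g (enum 'I_m) b 0 (([::] ++ num n) ++ num m)
  xs z o le_h.
exists g' => //.
set T := tapes5 (zipper _ [::]) _ _ _ _ in H3.
have := @exec_home tin g' _ _ _ (erefl : T tin = zipper _ _).
rewrite /T set_tapes5 cats0 -!catA => H4.
rewrite {}/T -!catA in H2 H3.
apply: exec_le (exec_seq H1 (exec_seq H2 (exec_seq H3 H4))).
by rewrite !size_cat !size_num -/u; lia.
Qed.

Lemma exec_trial g (I : instance pb k) b base h xs suf z o :
  base <= h ->
  let w := instance_word I in
  (size suf <= 1)%N ->
  exists2 g', g'.2 = g.2 &
  exec (trial b) (10 * size w + 4 * size xs + 22)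
    (g, tapes5 (zipper [::] w) (zipper xs suf) z (counter b base h 0) o)
    (g', tapes5 (zipper [::] w) (zipper xs [:: b]) z
       (counter b base h (nviol I (rcons xs b))) o).
Proof.
move=> le_h w size_suf; set c := counter b base h.
have H1 : exec (wr tX b Stay) 1
    (g, tapes5 (zipper [::] w) (zipper xs suf) z (c 0%N) o)
    (g, tapes5 (zipper [::] w) (zipper xs [:: b]) z (c 0%N) o).
  apply: exec_wr; rewrite set_tapes5 /=.
  by case: suf size_suf => [|a [|]] // _; rewrite (put_here, put_here_end).
have := @exec_home tX g
  (tapes5 (zipper [::] w) (zipper xs [:: b]) z (c 0%N) o) _ _ erefl.
rewrite set_tapes5 cats1 => H2.
have [g' g'2 H3] := exec_pass g I b (rcons xs b) z o le_h.
exists g' => //.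
have := @exec_to_last tX g'
  (tapes5 (zipper [::] w) (zipper [::] (rcons xs b)) z
     (c (nviol I (rcons xs b))) o) _ _ xs b erefl erefl.
rewrite set_tapes5 => H4.
apply: exec_le (exec_seq H1 (exec_seq H2 (exec_seq H3 H4))).
by rewrite size_rcons -/w; lia.
Qed.

Lemma nviol_le (I : instance pb k) xs : (nviol I xs <= nconstrs I)%N.
Proof. by rewrite /nviol (leq_trans (count_size _ _)) // size_enum_ord. Qed.

Lemma size_greedy (I : instance pb k) i : size (greedy I i) = i.
Proof. by elim: i => //= i IH; rewrite size_rcons IH. Qed.

(** [v] only bounds the number of marks left, so that the first count alone can serve in the time
    estimate. *)
Lemma exec_clear g base h v a x z o : h <= base + v%:Z ->
  exists e, exec (While tC nonblank (Op tC (fun g r => (g, (None, MoveLeft)))))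
    (2 * v + 1)
    (g, tapes5 a x z (stack_top base h) o) (g, tapes5 a x z (stack e e) o).
Proof.
elim: v h => [|v IH] h le_h; case: (ltrP base h) => [lt_h|ge_h].
- by lia.
- by exists (h - 1); rewrite -(stack_empty ge_h); apply: exec_while_exit;
    rewrite /= read_stack_top ltNge ge_h.
- have [|e H2] := IH (h - 1); first by lia.
  exists e; have H1 : exec (Op tC (fun g r => (g, (None, MoveLeft)))) 1
      (g, tapes5 a x z (stack_top base h) o)
      (g, tapes5 a x z (stack_top base (h - 1)) o).
    by apply: exec_op_to; [reflexivity|rewrite /= pop_stack set_tapes5].
  apply: exec_le (exec_while_loop _ H1 H2); first by lia.
  by rewrite /= read_stack_top lt_h.
exists (h - 1); rewrite -(stack_empty ge_h).
apply: (exec_le (t := 1)); first by lia.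
by apply: exec_while_exit; rewrite /= read_stack_top ltNge ge_h.
Qed.

Lemma exec_decide g base h v xs c a z o : h <= base + v%:Z ->
  exists e, exec decide (2 * v + 3)
    (g, tapes5 a (zipper xs [:: c]) z (stack_top base h) o)
    (g.1, base < h, tapes5 a (zipper xs [:: base < h]) z (stack e e) o).
Proof.
move=> le_h; set T := tapes5 _ _ _ _ _; set b := base < h.
have [e H3] := exec_clear (g.1, b) a (zipper xs [:: b]) z o le_h.
exists e.
have H1 : exec (Op tC (fun g r => ((g.1, r == Some true), (r, Stay)))) 1
    (g, T) (g.1, b, T).
  apply: (exec_op_to (w := read (T tC)) (d := Stay)).
    by rewrite /= read_stack_top -/b; case: (b).
  by rewrite put_stay set_tape_id.
have H2 : exec (Op tX (fun g r => (g, (Some g.2, Stay)))) 1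
    (g.1, b, T) (g.1, b, tapes5 a (zipper xs [:: b]) z (stack_top base h) o).
  by apply: exec_op_to; [reflexivity|rewrite set_tapes5 /= put_here].
by apply: exec_le (exec_seq H1 (exec_seq H2 H3)); lia.
Qed.

Lemma exec_emit_var g xs b a z c o :
  exec emit_var (5 * size xs + 8)
    (g, tapes5 a (zipper xs [:: b]) z c (zipper o [::]))
    (g, tapes5 a (zipper xs [:: b]) z c (zipper (o ++ num (size xs)) [::])).
Proof.
have loop u v o' : ohead v -> exec
    (While tX nonblank (Seq (wr tout true MoveRight) (mv tX MoveLeft)))
    (3 * size u + 4)
    (g, tapes5 a (zipper u v) z c (zipper o' [::]))
    (g, tapes5 a (leftend (u ++ v)) z c (zipper (o' ++ nseq (size u).+1 true) [::])).
  elim/last_ind: u v o' => [|u d IH] v o' v0.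
    have H1 : exec (wr tout true MoveRight) 1
        (g, tapes5 a (zipper [::] v) z c (zipper o' [::]))
        (g, tapes5 a (zipper [::] v) z c (zipper (o' ++ [:: true]) [::])).
      by apply: exec_wr; rewrite set_tapes5 /= put_right_end cats1.
    have H2 : exec (mv tX MoveLeft) 1
        (g, tapes5 a (zipper [::] v) z c (zipper (o' ++ [:: true]) [::]))
        (g, tapes5 a (leftend v) z c (zipper (o' ++ [:: true]) [::])).
      by apply: exec_mv; rewrite set_tapes5 /= read_zipper put_left_end.
    have H3 : exec (While tX nonblank (Seq (wr tout true MoveRight) (mv tX MoveLeft)))
        1 (g, tapes5 a (leftend v) z c (zipper (o' ++ [:: true]) [::]))
        (g, tapes5 a (leftend v) z c (zipper (o' ++ [:: true]) [::])).
      exact: exec_while_exit.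
    apply: exec_le (exec_while_loop _ (exec_seq H1 H2) H3) => //.
  have H1 : exec (wr tout true MoveRight) 1
      (g, tapes5 a (zipper (rcons u d) v) z c (zipper o' [::]))
      (g, tapes5 a (zipper (rcons u d) v) z c (zipper (o' ++ [:: true]) [::])).
    by apply: exec_wr; rewrite set_tapes5 /= put_right_end cats1.
  have H2 : exec (mv tX MoveLeft) 1
      (g, tapes5 a (zipper (rcons u d) v) z c (zipper (o' ++ [:: true]) [::]))
      (g, tapes5 a (zipper u (d :: v)) z c (zipper (o' ++ [:: true]) [::])).
    by apply: exec_mv; rewrite set_tapes5 /= read_zipper put_left.
  have H3 := IH (d :: v) (o' ++ [:: true]) isT.
  rewrite -catA -(cat_rcons d) in H3; rewrite size_rcons.
  apply: exec_le (exec_while_loop _ (exec_seq H1 H2) H3); first by lia.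
  by rewrite /= read_zipper.
have H123 : exec
    (Seq (mv tX MoveLeft)
         (While tX nonblank (Seq (wr tout true MoveRight) (mv tX MoveLeft))))
    (3 * size xs + 2)
    (g, tapes5 a (zipper xs [:: b]) z c (zipper o [::]))
    (g, tapes5 a (leftend (rcons xs b)) z c
               (zipper (o ++ nseq (size xs) true) [::])).
  case/lastP: xs => [|u d].
    have H1 : exec (mv tX MoveLeft) 1
        (g, tapes5 a (zipper [::] [:: b]) z c (zipper o [::]))
        (g, tapes5 a (leftend [:: b]) z c (zipper o [::])).
      by apply: exec_mv; rewrite set_tapes5 /= read_zipper put_left_end.
    rewrite cats0; apply: exec_le (exec_seq H1 (exec_while_exit _ _)) => //.
  have H1 : exec (mv tX MoveLeft) 1
      (g, tapes5 a (zipper (rcons u d) [:: b]) z c (zipper o [::]))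
      (g, tapes5 a (zipper u [:: d; b]) z c (zipper o [::])).
    by apply: exec_mv; rewrite set_tapes5 /= read_zipper put_left.
  have H2 := loop u [:: d; b] o isT; rewrite size_rcons.
  rewrite -(cats1 _ b) cat_rcons.
  by apply: exec_le (exec_seq H1 H2); lia.
have H4 : exec (mv tX MoveRight) 1
    (g, tapes5 a (leftend (rcons xs b)) z c (zipper (o ++ nseq (size xs) true) [::]))
    (g, tapes5 a (zipper [::] (rcons xs b)) z c
               (zipper (o ++ nseq (size xs) true) [::])).
  by apply: exec_mv; rewrite set_tapes5 /= read_leftend put_leftend.
have H5 : exec (wr tout false MoveRight) 1
    (g, tapes5 a (zipper [::] (rcons xs b)) z c
               (zipper (o ++ nseq (size xs) true) [::]))
    (g, tapes5 a (zipper [::] (rcons xs b)) z c (zipper (o ++ num (size xs)) [::])).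
  by apply: exec_wr; rewrite set_tapes5 /= put_right_end -rcons_cat.
have := @exec_to_last tX g (tapes5 a (zipper [::] (rcons xs b)) z c
  (zipper (o ++ num (size xs)) [::])) _ _ xs b erefl erefl.
rewrite set_tapes5 size_rcons => H6.
by apply: exec_le (exec_seq H123 (exec_seq H4 (exec_seq H5 H6))); lia.
Qed.

Lemma exec_emit_gate t g xs b a z c o :
  exec (emit_gate t) (5 * size xs + 10)
    (g, tapes5 a (zipper xs [:: b]) z c (zipper o [::]))
    (g, tapes5 a (zipper xs [:: b]) z c
          (zipper (o ++ unary [:: nat_of_bool t; size xs]) [::])).
Proof.
have H1 d o' : exec (wr tout d MoveRight) 1
    (g, tapes5 a (zipper xs [:: b]) z c (zipper o' [::]))
    (g, tapes5 a (zipper xs [:: b]) z c (zipper (o' ++ [:: d]) [::])).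
  by apply: exec_wr; rewrite set_tapes5 /= put_right_end cats1.
have H2 o' := exec_emit_var g xs b a z c (o' ++ [:: false]).
case: t; rewrite unary_cons (unary_cons _ [::]) cats0.
  have := exec_seq (H1 true o) (exec_seq (H1 false _) (H2 _)).
  by rewrite -!catA; apply: exec_le; lia.
have := exec_seq (H1 false o) (H2 o).
by rewrite -!catA; apply: exec_le; lia.
Qed.

Definition gates_word (ts : seq bool) (i : nat) : seq nat :=
  flatten [seq [:: nat_of_bool t; i] | t <- ts].

Lemma exec_emit_gates ts g xs b a z c o :
  exec (emit_gates ts) (size ts * (5 * size xs + 10) + 1)
    (g, tapes5 a (zipper xs [:: b]) z c (zipper o [::]))
    (g.1, false, tapes5 a (zipper xs [:: b]) z c
          (zipper (o ++ unary (gates_word ts (size xs))) [::])).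
Proof.
elim: ts o => [|t ts IH] o.
  rewrite cats0; apply: exec_op_to; first reflexivity.
  by rewrite put_stay set_tape_id.
have H1 := exec_emit_gate t g xs b a z c o.
have := IH (o ++ unary [:: nat_of_bool t; size xs]).
rewrite -catA -unary_cat => H2.
by apply: exec_le (exec_seq H1 H2); rewrite /= mulSn; lia.
Qed.

Lemma exec_emit f g xs b a z c o :
  exec emit (30 * size xs + 64)
    (g.1, f, tapes5 a (zipper xs [:: b]) z c (zipper o [::]))
    (g.1, false, tapes5 a (zipper xs [:: b]) z c
      (zipper (o ++ unary (if f then gates_word not_codes (size xs) else [::]))
              [::])).
Proof.
case: f; last first.
  rewrite cats0; apply: (exec_le (t := 1)); first by lia.
  exact: exec_while_exit.
have H1 := exec_emit_gates not_codes (g.1, true) xs b a z c o.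
by apply: exec_le (exec_while_loop _ H1 (exec_while_exit _ _)) => //=; lia.
Qed.

Definition word_of_values (f : nat -> bool) (s : seq nat) : seq nat :=
  flatten [seq if f i then gates_word not_codes i else [::] | i <- s].

Lemma size_instance_word (I : instance pb k) :
  (nvars I + nconstrs I + 2 <= size (instance_word I))%N.
Proof. by rewrite instance_wordE !size_cat !size_num; lia. Qed.

(** Invariant of the outer loop: [tX] holds the greedy prefix with its head just after it, the
    counter is blank with its head at some [e], and the flag is down. *)
Lemma exec_body g (I : instance pb k) i zs zr e o :
  (i <= nvars I)%N -> g.2 = false ->
  let w := instance_word I in
  let f := best_value I (greedy I i) in
  exists g' e', g'.2 = false /\
  exec body (60 * size w + 120)
    (g, tapes5 (zipper [::] w) (zipper (greedy I i) [::])
          (zipper zs (true :: zr)) (stack e e) (zipper o [::]))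
    (g', tapes5 (zipper [::] w) (zipper (greedy I i.+1) [::])
          (zipper (rcons zs true) zr) (stack e' e')
          (zipper (o ++ unary (if f then gates_word not_codes i else [::])) [::])).
Proof.
move=> le_i g2 w f.
set xs := greedy I i; set z := zipper zs _.
set v0 := nviol I (rcons xs false); set v1 := nviol I (rcons xs true).
have [g1 g12] := exec_trial g I false (base := e) xs (suf := [::]) z
  (zipper o [::]) (lexx e) isT.
rewrite -/w -/v0 {1}/counter addr0 => H1.
(* From the first free cell to the last mark: the counter passes from pushing to popping. *)
have H2 : exec (mv tC MoveLeft) 1
    (g1, tapes5 (zipper [::] w) (zipper xs [:: false]) z (stack e (e + v0%:Z))
           (zipper o [::]))
    (g1, tapes5 (zipper [::] w) (zipper xs [:: false]) z
           (counter true e (e + v0%:Z) 0) (zipper o [::])).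
  by apply: exec_mv; rewrite set_tapes5 /= read_stack stack_to_top subr0.
have [|g2' g22 H3] := exec_trial g1 I true (base := e) (h := e + v0%:Z) xs
  (suf := [:: false]) z (zipper o [::]) _ isT; first by lia.
have [|e' H4] := @exec_decide g2' e (e + v0%:Z - v1%:Z) v0 xs true
  (zipper [::] w) z (zipper o [::]); first by lia.
have fE : (e < e + v0%:Z - v1%:Z) = f.
  by rewrite /f /best_value -/xs -/v0 -/v1; lia.
rewrite fE in H4.
have H5 := exec_emit f g2' xs f (zipper [::] w) z (stack e' e') o.
rewrite size_greedy in H5.
set o' := o ++ _ in H5.
have H6 : exec (mv tX MoveRight) 1
    (g2'.1, false, tapes5 (zipper [::] w) (zipper xs [:: f]) z (stack e' e')
           (zipper o' [::]))
    (g2'.1, false, tapes5 (zipper [::] w) (zipper (greedy I i.+1) [::]) z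
           (stack e' e') (zipper o' [::])).
  by apply: exec_mv; rewrite set_tapes5 /= read_zipper put_right.
have H7 : exec (mv tZ MoveRight) 1
    (g2'.1, false, tapes5 (zipper [::] w) (zipper (greedy I i.+1) [::]) z
           (stack e' e') (zipper o' [::]))
    (g2'.1, false, tapes5 (zipper [::] w) (zipper (greedy I i.+1) [::])
           (zipper (rcons zs true) zr) (stack e' e') (zipper o' [::])).
  by apply: exec_mv; rewrite set_tapes5 /= read_zipper put_right.
exists (g2'.1, false), e'; split=> //.
apply: exec_le (exec_seq H1 (exec_seq H2 (exec_seq H3 (exec_seq H4
  (exec_seq H5 (exec_seq H6 H7)))))).
have := nviol_le I (rcons xs false); have := size_instance_word I.
by rewrite size_greedy -/w -/v0; lia.
Qed.

Lemma exec_loop g (I : instance pb k) r i zs e o :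
  (i + r = nvars I)%N -> g.2 = false ->
  let w := instance_word I in
  exists g' T, exec (While tZ nonblank body) (r * (60 * size w + 121) + 1)
    (g, tapes5 (zipper [::] w) (zipper (greedy I i) [::])
          (zipper zs (nseq r true)) (stack e e) (zipper o [::]))
    (g', T) /\
    T tout = zipper
      (o ++ unary (word_of_values (fun i => best_value I (greedy I i)) (iota i r)))
      [::].
Proof.
elim: r i g zs e o => [|r IH] i g zs e o E g2 w.
  exists g, (tapes5 (zipper [::] w) (zipper (greedy I i) [::])
    (zipper zs [::]) (stack e e) (zipper o [::])); rewrite cats0; split=> //.
  by apply: exec_while_exit; rewrite /= read_zipper.
have [|g1 [e1 [g12 H1]]] := @exec_body g I i zs (nseq r true) e o _ g2.
  by lia.
have [|g' [T [H2 HT]]] := IH i.+1 g1 (rcons zs true) e1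
  (o ++ unary (if best_value I (greedy I i) then gates_word not_codes i else [::]))
  _ g12; first by lia.
exists g', T; split; last by rewrite HT -catA -unary_cat.
apply: exec_le (exec_while_loop _ H1 H2); first by rewrite mulSn -/w; lia.
by rewrite /= read_zipper.
Qed.

Lemma exec_header g n suf x c :
  exec header (8 * n + 10)
    (g, tapes5 (zipper [::] (num n ++ suf)) x (zipper [::] [::]) c (zipper [::] [::]))
    (g, tapes5 (zipper [::] (num n ++ suf)) x (zipper [::] (nseq n true)) c
          (zipper (num n) [::])).
Proof.
rewrite /header; set copy := Seq (mv tin MoveRight) _.
have loop u v o : exec (While tin one copy) (4 * n + 1)
    (g, tapes5 (zipper u (num n ++ suf)) x (zipper v [::]) c (zipper o [::]))
    (g, tapes5 (zipper (u ++ nseq n true) (false :: suf)) x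
          (zipper (v ++ nseq n true) [::]) c (zipper (o ++ nseq n true) [::])).
  elim: n u v o => [|n IH] u v o.
    by rewrite !cats0; apply: exec_while_exit; rewrite /= read_zipper.
  have H : exec copy (1 + (1 + 1))
      (g, tapes5 (zipper u (num n.+1 ++ suf)) x (zipper v [::]) c (zipper o [::]))
      (g, tapes5 (zipper (u ++ [:: true]) (num n ++ suf)) x
            (zipper (v ++ [:: true]) [::]) c (zipper (o ++ [:: true]) [::])).
    have Hin : exec (mv tin MoveRight) 1
        (g, tapes5 (zipper u (num n.+1 ++ suf)) x (zipper v [::]) c (zipper o [::]))
        (g, tapes5 (zipper (u ++ [:: true]) (num n ++ suf)) x (zipper v [::]) c
              (zipper o [::])).
      by apply: exec_mv; rewrite set_tapes5 /= read_zipper put_right cats1.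
    have HZ : exec (wr tZ true MoveRight) 1
        (g, tapes5 (zipper (u ++ [:: true]) (num n ++ suf)) x (zipper v [::]) c
              (zipper o [::]))
        (g, tapes5 (zipper (u ++ [:: true]) (num n ++ suf)) x
              (zipper (v ++ [:: true]) [::]) c (zipper o [::])).
      by apply: exec_wr; rewrite set_tapes5 /= put_right_end !cats1.
    apply: exec_seq Hin (exec_seq HZ _); apply: exec_wr.
    by rewrite set_tapes5 /= put_right_end !cats1.
  have := IH (u ++ [:: true]) (v ++ [:: true]) (o ++ [:: true]).
  rewrite -!catA => H2.
  by apply: exec_le (exec_while_loop _ H H2); [lia|rewrite /= read_zipper].
have H2 : exec (wr tout false MoveRight) 1
    (g, tapes5 (zipper ([::] ++ nseq n true) (false :: suf)) x
          (zipper ([::] ++ nseq n true) [::]) c (zipper ([::] ++ nseq n true) [::]))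
    (g, tapes5 (zipper (nseq n true) (false :: suf)) x
          (zipper (nseq n true) [::]) c (zipper (num n) [::])).
  by apply: exec_wr; rewrite set_tapes5 /= put_right_end.
have := @exec_home tin g (tapes5 (zipper (nseq n true) (false :: suf)) x
          (zipper (nseq n true) [::]) c (zipper (num n) [::])) _ _ erefl.
rewrite set_tapes5 -cat_rcons => H3.
have := @exec_home tZ g (tapes5 (zipper [::] (num n ++ suf)) x
          (zipper (nseq n true) [::]) c (zipper (num n) [::])) _ _ erefl.
rewrite set_tapes5 cats0 => H4.
apply: exec_le (exec_seq (loop [::] [::] [::]) (exec_seq H2 (exec_seq H3 H4))).
by rewrite size_nseq; lia.
Qed.

Definition output_word (I : instance pb k) : seq bool :=
  unary (nvars I ::
    word_of_values (fun i => best_value I (greedy I i)) (iota 0 (nvars I))).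

Definition reg0 : reg := ([ffun=> false], [ffun=> None], false).

(** Each variable costs two passes, linear in the length of the input, and the unary header makes
    the number of variables at most that length. *)
Lemma main_computes (I : instance pb k) :
  let w := instance_word I in
  exists2 t, (t <= 200 * size w ^ 2 + 200)%N &
    computes_in (machine_of reg0 main) t w (output_word I).
Proof.
move=> w; set n := nvars I.
have H1 := exec_header reg0 n
  (num (nconstrs I) ++ unary (flatten [seq @constr_word I l | l <- enum 'I_(nconstrs I)]))
  (zipper [::] [::]) (stack 0 0).
rewrite -/(instance_wordE I) in H1.
have [g [T [H2 HT]]] := @exec_loop reg0 I n 0 [::] 0 (num n) (add0n _) erefl.
have := exec_seq H1 H2; set T0 := tapes5 _ _ _ _ _.
(* The empty word and the empty stack are blank tapes, so this is the initial configuration. *)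
have -> : T0 = fun i => (0, if i == ord0 then tape_of_word w else fun=> None).
  have E : tape_of_word [::] = fun=> None by apply/funext => -[[|p]|p].
  apply/funext => -[[|[|[|[|[|//]]]]] lt_i]; rewrite /T0 /tapes5 /zipper /= ?E //.
  congr pair; apply/funext => p; rewrite /stack_content.
  by case: ifP => //; lia.
move=> H; have [] := exec_computes (v := output_word I) H.
  have -> : ord_max = tout by apply: val_inj.
  by rewrite [(g, T).2]/= HT /zipper [X in X =1 _]/= cats0.
move=> t le_t Ht; exists t => //; apply: leq_trans le_t _.
have := size_instance_word I; rewrite -/n -/w.
have : (n <= size w)%N by have := size_instance_word I; rewrite -/n -/w; lia.
by nia.
Qed.

End Program.

(** * The circuit *)

Definition gate_of N (t : bool) (i : 'I_N) : gate N := if t then GateT i else GateH i.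

Definition not_circuit N (i : 'I_N) : circuit N := [seq gate_of t i | t <- not_codes].

Definition flip_circuit n (x : assignment n) : circuit (n + 0) :=
  flatten [seq if x i then not_circuit (lshift 0 i) else [::] | i <- enum 'I_n].

Lemma flip_circuit_word n (x : assignment n) (f : nat -> bool) :
  (forall i : 'I_n, x i = f i) ->
  circuit_word (flip_circuit x) = unary (n :: word_of_values f (iota 0 n)).
Proof.
move=> xf; rewrite /circuit_word; congr (unary (_ :: _)); first exact: addn0.
rewrite /word_of_values -val_enum_ord -map_comp /flip_circuit.
elim: (enum _) => //= i s IH; rewrite map_cat flatten_cat IH -xf.
by case: (x i).
Qed.

Section Semantics.
Variable C : numClosedFieldType.

Lemma set_bit_same N (x : basis N) i : set_bit x i (x i) = x.
Proof. by apply/ffunP => j; rewrite ffunE; case: eqP => [->|]. Qed.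

Lemma set_bit_at N (x : basis N) i b : set_bit x i b i = b.
Proof. by rewrite ffunE eqxx. Qed.

Lemma set_set_bit N (x : basis N) i b c :
  set_bit (set_bit x i b) i c = set_bit x i c.
Proof. by apply/ffunP => j; rewrite !ffunE; case: eqP. Qed.

Lemma apply_T N (i : 'I_N) (psi : qstate C N) :
  apply1 (tphase C) i psi =
  fun x => (if x i then (1 + 'i) / sqrtC 2 else 1) * psi x.
Proof.
apply/funext => x; rewrite /apply1 big_bool /tphase.
by case E: (x i); rewrite /= mul0r ?addr0 ?add0r -{1}E set_bit_same.
Qed.

(** The phase is an eighth root of unity whose square is ['i]. *)
Lemma tphase4 : ((1 + 'i) / sqrtC 2) ^+ 4 = -1 :> C.
Proof.
have E : (1 + 'i) ^+ 2 = 'i *+ 2 :> C.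
  by rewrite sqrrD expr1n sqrCi mul1r addrAC subrr add0r.
rewrite expr_div_n (exprM _ 2 2) (exprM (sqrtC 2) 2 2) sqrtCK E (exprMn_n 'i) sqrCi.
by rewrite mulNrn mulNr -natrX divff ?pnatr_eq0.
Qed.

(** [T^4] is the phase flip [Z], and conjugating [Z] by the Hadamard gate gives [X]. *)
Lemma run_not N (i : 'I_N) (psi : qstate C N) :
  foldl (fun psi g => apply_gate g psi) psi (not_circuit i) =
  fun x => psi (set_bit x i (~~ x i)).
Proof.
rewrite /= !apply_T; apply/funext => x.
have s2 : (sqrtC 2 : C) != 0 by rewrite sqrtC_eq0 pnatr_eq0.
have s22 : (sqrtC 2 : C) * sqrtC 2 = 2 by rewrite -expr2 sqrtCK.
rewrite {1}/apply1 big_bool !set_bit_at !mul1r.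
set w := (1 + 'i) / _.
have w4 u : w * (w * (w * (w * u))) = - u.
  by rewrite -mulN1r -tphase4 -/w !exprS expr0 mulr1 !mulrA.
rewrite w4 /apply1 !big_bool !set_bit_at !set_set_bit /hadamard /=.
set p := psi _; set q := psi (set_bit x i false).
(* The two paths to the unflipped bit cancel; the two to the flipped bit add up to amplitude 1. *)
set r := (sqrtC 2)^-1; have r2 : r * r * 2 = 1.
  by rewrite -invfM s22 mulVf ?pnatr_eq0.
case: (x i) => /=; rewrite -/p -/q.
  by transitivity (r * r * 2 * q); [ring|rewrite r2 mul1r].
by transitivity (r * r * 2 * p); [ring|rewrite r2 mul1r].
Qed.

(** The circuit only permutes basis states; amplitudes are pulled back along this map. *)
Definition flip n a (x : assignment n) (s : seq 'I_n) (y : basis (n + a)) :=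
  foldr (fun i y => if x i then set_bit y (lshift a i) (~~ y (lshift a i)) else y) y s.

Lemma run_flips n (x : assignment n) (s : seq 'I_n) (psi : qstate C (n + 0)) :
  foldl (fun psi g => apply_gate g psi) psi
    (flatten [seq if x i then not_circuit (lshift 0 i) else [::] | i <- s]) =
  fun y => psi (flip x s y).
Proof.
elim: s psi => //= i s IH psi; rewrite foldl_cat IH.
apply/funext => y; case: (x i) => //.
by rewrite (run_not (lshift 0 i)).
Qed.

Lemma flipE n (x : assignment n) (s : seq 'I_n) (y : basis (n + 0)) i : uniq s ->
  flip x s y (lshift 0 i) = y (lshift 0 i) (+) (x i && (i \in s)).
Proof.
elim: s => [|j s IH] /=; first by rewrite andbF addbF.
case/andP => js /IH {}IH; rewrite inE; have [ij|ne_ij] /= := eqVneq i j.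
  rewrite -ij in js *; rewrite (negbTE js) andbF addbF in IH.
  by case: (x i); rewrite ?set_bit_at IH ?andbT ?addbF ?addbT.
by case: (x j); rewrite // ffunE (inj_eq (@lshift_inj _ _)) (negbTE ne_ij).
Qed.

Lemma ord_lshift0 n (j : 'I_(n + 0)) : exists i : 'I_n, j = lshift 0 i.
Proof. by case: (split_ordP j) => [i ->|[]//]; exists i. Qed.

Lemma output_assignment_inj n : injective (@output_assignment n 0).
Proof.
move=> y z /ffunP yz; apply/ffunP => j; have [i ->] := ord_lshift0 j.
by have := yz i; rewrite !ffunE.
Qed.

Lemma run_flip_circuit n (x : assignment n) (y : basis (n + 0)) :
  run_circuit C (flip_circuit x) y = (output_assignment y == x)%:R.
Proof.
rewrite /run_circuit run_flips; congr (nat_of_bool _)%:R.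
apply/eqP/eqP => [/ffunP E|E].
  apply/ffunP => i; have := E (lshift 0 i).
  rewrite flipE ?enum_uniq // mem_enum andbT !ffunE => /eqP.
  by case: (y _) (x i) => [] [].
apply/ffunP => j; have [i ->] := ord_lshift0 j.
by rewrite flipE ?enum_uniq // mem_enum andbT -E !ffunE addbb.
Qed.

Lemma measure_flip_circuit n (x : assignment n) (P : pred (assignment n)) :
  P x -> measure_prob C (flip_circuit x) [pred y | P (output_assignment y)] = 1.
Proof.
move=> Px; pose y0 : basis (n + 0) := [ffun j => x (cast_ord (addn0 n) j)].
have y0x : output_assignment y0 = x.
  by apply/ffunP => i; rewrite !ffunE; congr (x _); apply: val_inj.
rewrite /measure_prob (bigD1 y0) /= ?inE ?y0x // big1 => [|y /andP[_ ne_y]].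
  by rewrite run_flip_circuit y0x eqxx normr1 expr1n addr0.
rewrite run_flip_circuit -[in _ == x]y0x (inj_eq (@output_assignment_inj n)).
by rewrite (negbTE ne_y) normr0 expr0n.
Qed.

End Semantics.

(** * Means over finite product spaces *)

Section Mean.
Variable R : rcfType.

Definition mean (U : finType) (f : U -> R) : R := (\sum_u f u) / #|U|%:R.

Section MeanTheory.
Variable U : finType.
Implicit Types f g : U -> R.

Lemma eq_mean f g : f =1 g -> mean f = mean g.
Proof. by move=> fg; congr (_ / _); apply: eq_bigr. Qed.

Lemma meanD f g : mean (fun u => f u + g u) = mean f + mean g.
Proof. by rewrite /mean big_split mulrDl. Qed.

Lemma meanZ c f : mean (fun u => c * f u) = c * mean f.
Proof. by rewrite /mean -mulr_sumr mulrA. Qed.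

Lemma meanN f : mean (fun u => - f u) = - mean f.
Proof. by rewrite /mean sumrN mulNr. Qed.

Lemma mean_sum (I : finType) (P : pred I) (F : I -> U -> R) :
  mean (fun u => \sum_(i | P i) F i u) = \sum_(i | P i) mean (F i).
Proof. by rewrite /mean exchange_big /= mulr_suml. Qed.

Lemma ler_mean f g : (forall u, f u <= g u) -> mean f <= mean g.
Proof.
by move=> fg; rewrite ler_wpM2r ?invr_ge0 ?ler0n // ler_sum.
Qed.

Lemma mean_ge0 f : (forall u, 0 <= f u) -> 0 <= mean f.
Proof. by move=> f0; rewrite divr_ge0 ?ler0n ?sumr_ge0. Qed.

Lemma mean_reindex (h : U -> U) f : injective h -> mean (f \o h) = mean f.
Proof.
by move=> h_inj; congr (_ / _); rewrite [RHS](reindex_inj h_inj).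
Qed.

(** Reindexing by [h] shows that the mean is its own opposite. With a sign reversal at one
    coordinate as [h], this removes the odd cross terms of the moments below. *)
Lemma mean_odd (h : U -> U) f : involutive h -> (forall u, f (h u) = - f u) ->
  mean f = 0.
Proof.
move=> hK fN; have E := mean_reindex f (inv_inj hK).
have : mean (f \o h) = - mean f by rewrite -meanN; apply: eq_mean.
by rewrite E; lra.
Qed.

Hypothesis U_gt0 : (0 < #|U|)%N.

Lemma mean_const c : mean (fun _ : U => c) = c.
Proof.
by rewrite /mean sumr_const -(mulr_natr c) mulfK // pnatr_eq0 -lt0n.
Qed.

(** Pointwise, [d^2] times the indicator is at most the squared deviation. *)
Lemma chebyshev f (d : R) : 0 < d ->
  mean (fun u => (d < f u - mean f)%R%:R) <=
    mean (fun u => (f u - mean f) ^+ 2) / d ^+ 2.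
Proof.
move=> d0; rewrite ler_pdivlMr ?exprn_gt0 // mulrC -meanZ.
apply: ler_mean => u; case: ltP => [lt_d|_]; last by rewrite mulr0 sqr_ge0.
by rewrite mulr1 lerXn2r ?nnegrE ?ltW // (lt_trans d0).
Qed.

End MeanTheory.

(** * Marginals and independence *)

Section Product.
Variables (I A : finType).
Hypothesis A_gt0 : (0 < #|A|)%N.
Local Notation T := {ffun I -> A}.

Lemma card_product_gt0 : (0 < #|{: T}|)%N.
Proof. by rewrite card_ffun expn_gt0 A_gt0. Qed.

(** A sum over functions of a product of one-coordinate factors is a product of sums; every factor
    other than that of [i] contributes [#|A|]. *)
Lemma mean_marginal (f : A -> R) (i : I) : mean (fun t : T => f (t i)) = mean f.
Proof.
rewrite /mean card_ffun.
have E : \sum_(t : T) f (t i) = \prod_j \sum_a (if j == i then f a else 1).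
  rewrite bigA_distr_bigA; apply: eq_bigr => t _.
  by rewrite (bigD1 i) //= eqxx big1 ?mulr1 // => j /negbTE->.
have E' : \prod_(j | j != i) \sum_a (if j == i then f a else 1) =
    #|A|%:R ^+ #|I|.-1 :> R.
  rewrite -(cardC1 i) -prodr_const; apply: eq_big => [j|j /negbTE->].
    by rewrite !inE.
  by rewrite sumr_const.
rewrite E (bigD1 i) //= E'.
rewrite eqxx; have I_gt0 : (0 < #|I|)%N by apply/card_gt0P; exists i.
have A0 : #|A|%:R != 0 :> R by rewrite pnatr_eq0 -lt0n.
by rewrite natrX -{2}(prednK I_gt0) exprSr invfM mulrA mulfK ?expf_neq0.
Qed.

Definition mix (B : pred I) (t t' : T) : T := [ffun i => if B i then t i else t' i].

(** Let two copies [t] and [t'] exchange their coordinates outside [B]: [f t * g t'] turns into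
    [f t * g t], so the double sum is [#|T|] times a single one. *)
Lemma mean_indep (B : pred I) (f g : T -> R) :
  (forall t t' : T, (forall i, B i -> t i = t' i) -> f t = f t') ->
  (forall t t' : T, (forall i, ~~ B i -> t i = t' i) -> g t = g t') ->
  mean (fun t => f t * g t) = mean f * mean g.
Proof.
move=> fB gB.
pose swap (u : T * T) := (mix B u.1 u.2, mix B u.2 u.1).
have swapK : involutive swap.
  by case=> t t'; congr pair; apply/ffunP => i; rewrite !ffunE; case: (B i).
have T0 : #|{: T}|%:R != 0 :> R by rewrite pnatr_eq0 -lt0n card_product_gt0.
have E : (\sum_t f t) * (\sum_t g t) = #|{: T}|%:R * \sum_t f t * g t.
  rewrite big_distrlr /= pair_bigA /= (reindex_inj (inv_inj swapK)) /=.
  rewrite -(pair_bigA _ (fun t t' => f (mix B t t') * g (mix B t' t))) /=.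
  rewrite mulr_sumr; apply: eq_bigr => t _; rewrite mulr_natl -sumr_const.
  apply: eq_bigr => t' _; congr (_ * _); [apply: fB|apply: gB] => i Bi.
    by rewrite ffunE Bi.
  by rewrite ffunE (negbTE Bi).
by rewrite /mean mulrACA E; field.
Qed.

End Product.
End Mean.

(** * Moments of the random votes and concentration of the greedy cost *)

Section Majority.
Variables (R : rcfType) (I A J : finType) (a0 : A) (sigma : I -> A -> A).
Variable blk : I -> J.
Hypothesis sigmaK : forall i, involutive (sigma i).
Hypothesis sigma0 : forall i, sigma i a0 != a0.
Local Notation T := {ffun I -> A}.
Implicit Types (i : I) (j : J) (t : T).

(** [a0] stands for the violating signs, [sigma i] for the effect on the signs of the other value of
    the last variable, and [blk i] for that variable; [p] is the probability that one of the two
    values violates constraint [i]. *)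
Let p : R := 2 / #|A|%:R.

Let A_gt0 : (0 < #|A|)%N. Proof. by apply/card_gt0P; exists a0. Qed.
Let T_gt0 : (0 < #|{: T}|)%N := card_product_gt0 I A_gt0.

Definition hit i t : R := (t i == a0)%:R.
Definition hit' i t : R := (sigma i (t i) == a0)%:R.
Definition drift i t : R := hit i t - hit' i t.

Lemma mean_pred1 (a : A) : mean (fun x : A => (x == a)%:R : R) = #|A|%:R^-1.
Proof.
rewrite /mean (bigD1 a) //= eqxx big1 ?addr0 ?mul1r // => x /negbTE->.
by [].
Qed.

Lemma mean_hit i : mean (hit i) = p / 2.
Proof.
rewrite (mean_marginal A_gt0 (fun a => (a == a0)%:R)) mean_pred1 /p.
by rewrite mulrAC mulfV ?mul1r // pnatr_eq0.
Qed.

Lemma mean_hit' i : mean (hit' i) = p / 2.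
Proof.
rewrite (mean_marginal A_gt0 (fun a => (sigma i a == a0)%:R)).
rewrite (mean_reindex (fun a => (a == a0)%:R) (inv_inj (sigmaK i))) mean_pred1 /p.
by rewrite mulrAC mulfV ?mul1r // pnatr_eq0.
Qed.

Lemma hit_hit' i t : hit i t * hit' i t = 0.
Proof.
rewrite /hit /hit'; case: eqP => [->|]; last by rewrite mul0r.
by rewrite (negbTE (sigma0 i)) mulr0.
Qed.

Lemma drift_sqr i t : drift i t ^+ 2 = hit i t + hit' i t.
Proof.
rewrite /drift sqrrB hit_hit' mul0rn subr0 /hit /hit'.
by case: eqP; case: eqP => _ _; rewrite ?expr1n ?expr0n.
Qed.

Lemma drift_sqr_le1 i t : drift i t ^+ 2 <= 1.
Proof.
rewrite drift_sqr; have := hit_hit' i t; rewrite /hit /hit'.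
by case: eqP; case: eqP => _ _; rewrite ?mulr1 ?addr0 ?add0r ?lexx ?ler01 //
  => /eqP; rewrite oner_eq0.
Qed.

Lemma drift_exp4 i t : drift i t ^+ 4 = drift i t ^+ 2.
Proof.
rewrite (exprM _ 2 2) drift_sqr sqrrD hit_hit' mul0rn addr0 /hit /hit'.
by case: eqP; case: eqP => _ _; rewrite ?expr1n ?expr0n.
Qed.

Lemma mean_drift_sqr i : mean (fun t => drift i t ^+ 2) = p.
Proof.
rewrite (eq_mean (drift_sqr i)) meanD mean_hit mean_hit'; lra.
Qed.

Definition flip_at i t : T := [ffun l => if l == i then sigma i (t l) else t l].

Lemma flip_atK i : involutive (flip_at i).
Proof.
move=> t; apply/ffunP => l; rewrite !ffunE; case: eqP => // _.
by rewrite sigmaK.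
Qed.

Lemma drift_flip i t : drift i (flip_at i t) = - drift i t.
Proof. by rewrite /drift /hit /hit' ffunE eqxx sigmaK opprB. Qed.

Definition walk (s : seq I) t : R := \sum_(i <- s) drift i t.

Lemma walk_flip i s t : i \notin s -> walk s (flip_at i t) = walk s t.
Proof.
move=> is'; apply: eq_big_seq => l ls.
have ne_li : l != i by apply: contraNneq is' => <-.
by rewrite /drift /hit /hit' ffunE (negbTE ne_li).
Qed.

(** The cross term is odd under [flip_at i], which fixes the walk over the other indices. *)
Lemma mean_walk2 s : uniq s -> mean (fun t => walk s t ^+ 2) = p * (size s)%:R.
Proof.
elim: s => [_|i s IH /= /andP[is' /IH{}IH]].
  rewrite mulr0 -(mean_const (U := {: T}) T_gt0 0); apply: eq_mean => t.
  by rewrite /walk big_nil expr0n.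
rewrite (@eq_mean _ _ _ (fun t => walk s t ^+ 2 + drift i t ^+ 2 +
                       2 * (drift i t * walk s t))) => [|t]; last first.
  by rewrite /walk big_cons; ring.
rewrite !meanD meanZ IH mean_drift_sqr.
rewrite (mean_odd (flip_atK i)) ?mulr0 => [|t].
  by rewrite -(natr1 (size s)); ring.
by rewrite drift_flip walk_flip // mulNr.
Qed.

(** Odd terms cancel as before, and in the mixed term one square is bounded by 1. This leaves a
    bound linear in [p], like the second moment with which it is compared; the induction step is
    [3 p d^2 + 6 p d + p <= 3 p (d + 1)^2]. *)
Lemma mean_walk4 s : uniq s ->
  mean (fun t => walk s t ^+ 4) <= 3 * p * (size s)%:R ^+ 2.
Proof.
elim: s => [_|i s IH /= /andP[is' us]].
  rewrite expr0n mulr0 -[leRHS](mean_const (U := {: T}) T_gt0 0).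
  by apply: ler_mean => t; rewrite /walk big_nil expr0n.
have {}IH := IH us.
have -> : mean (fun t => walk (i :: s) t ^+ 4) =
    mean (fun t => walk s t ^+ 4 + drift i t ^+ 2 +
                   6 * (walk s t ^+ 2 * drift i t ^+ 2)).
  rewrite (@eq_mean _ _ _ (fun t => walk s t ^+ 4 + drift i t ^+ 2 +
      6 * (walk s t ^+ 2 * drift i t ^+ 2) +
      4 * (drift i t * (walk s t ^+ 3 + walk s t * drift i t ^+ 2)))) => [|t]; last first.
    by rewrite -[X in walk s t ^+ 4 + X]drift_exp4 /walk big_cons; ring.
  rewrite [LHS]meanD meanZ.
  rewrite [X in 4 * X](_ : _ = 0) ?mulr0 ?addr0 //.
  apply: (mean_odd (flip_atK i)) => t.
  by rewrite drift_flip walk_flip // sqrrN mulNr.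
have H : mean (fun t => walk s t ^+ 2 * drift i t ^+ 2) <= p * (size s)%:R.
  rewrite -mean_walk2 //; apply: ler_mean => t.
  by rewrite ler_piMr ?sqr_ge0 ?drift_sqr_le1.
rewrite !meanD meanZ mean_drift_sqr -(natr1 (size s)).
have p0 : 0 <= p by rewrite divr_ge0 ?ler0n.
have -> : 3 * p * ((size s)%:R + 1) ^+ 2 =
    3 * p * (size s)%:R ^+ 2 + 6 * (p * (size s)%:R) + 3 * p by ring.
by lra.
Qed.

(* 2u - u^2 (3 - u^2) = u (u - 1)^2 (u + 2) *)
Lemma abs_lower_bound (z c : R) : 0 < c ->
  (3 * z ^+ 2 / c - z ^+ 4 / c ^+ 3) / 2 <= `|z|.
Proof.
move=> c0; set u := `|z| / c.
have u0 : 0 <= u by rewrite divr_ge0 ?normr_ge0 // ltW.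
have zu : `|z| = c * u by rewrite /u mulrCA mulfV ?mulr1 ?gt_eqF.
have z2 : z ^+ 2 = (c * u) ^+ 2 by rewrite -zu real_normK ?num_real.
rewrite zu {zu}.
rewrite (exprM z 2 2) z2 -subr_ge0.
have -> : c * u - (3 * (c * u) ^+ 2 / c - ((c * u) ^+ 2) ^+ 2 / c ^+ 3) / 2 =
    c * u * (u - 1) ^+ 2 * (u + 2) / 2 by field; rewrite gt_eqF.
rewrite divr_ge0 ?ler0n // mulr_ge0 ?addr_ge0 ?ler0n //.
by rewrite mulr_ge0 ?sqr_ge0 // mulr_ge0 // ltW.
Qed.

(** The pointwise bound with [c = 2 sqrt D], and [d <= D] in the fourth moment, give
    [(3/4 - 3/16) p d / sqrt D]; the factor 9/16 is rounded down to 1/2. *)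
Lemma mean_abs_walk s (D : R) : uniq s -> 0 < D -> (size s)%:R <= D ->
  p * (size s)%:R / (2 * Num.sqrt D) <= mean (fun t => `|walk s t|).
Proof.
move=> us D0 sD; set d := (size s)%:R in sD *; set q := Num.sqrt D.
have q0 : 0 < q by rewrite sqrtr_gt0.
have qD : q ^+ 2 = D by rewrite sqr_sqrtr // ltW.
have p0 : 0 <= p by rewrite divr_ge0 ?ler0n.
have d0 : 0 <= d by rewrite ler0n.
have := ler_mean (fun t => abs_lower_bound (walk s t) (mulr_gt0 (ltr0Sn R 1) q0)).
apply: le_trans.
rewrite (@eq_mean _ _ _ (fun t => 3 / (4 * q) * walk s t ^+ 2 +
    - (1 / (16 * q ^+ 3)) * walk s t ^+ 4)) => [|t]; last first.
  by field; rewrite gt_eqF.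
rewrite meanD !meanZ mean_walk2 // -/d.
have H4 := mean_walk4 us; rewrite -/d in H4.
have K0 : 0 < 1 / (16 * q ^+ 3) by rewrite divr_gt0 // mulr_gt0 ?exprn_gt0.
have H : - (1 / (16 * q ^+ 3)) * (3 * p * (d * q ^+ 2)) <=
    - (1 / (16 * q ^+ 3)) * mean (fun t => walk s t ^+ 4).
  rewrite ler_wnM2l ?oppr_le0 ?(ltW K0) // (le_trans H4) //.
  rewrite qD expr2; apply: ler_wpM2l; first exact: mulr_ge0 (ler0n R 3) p0.
  exact: ler_wpM2l.
apply: le_trans (lerD (lexx _) H); rewrite -subr_ge0.
have -> : 3 / (4 * q) * (p * d) + - (1 / (16 * q ^+ 3)) * (3 * p * (d * q ^+ 2))
   - p * d / (2 * q) = p * d / (16 * q) by field; rewrite gt_eqF.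
by apply: divr_ge0; [apply: mulr_ge0|rewrite mulr_ge0 ?ler0n // ltW].
Qed.

Definition block_size j : nat := #|[pred i | blk i == j]|.

Definition block_cost j t : R :=
  Num.min (\sum_(i | blk i == j) hit i t) (\sum_(i | blk i == j) hit' i t).

Definition cost t : R := \sum_j block_cost j t.

Lemma block_cost_ge0 j t : 0 <= block_cost j t.
Proof. by rewrite le_min !sumr_ge0 // => i _; rewrite ler0n. Qed.

Lemma block_cost_le j t : block_cost j t <= (block_size j)%:R.
Proof.
rewrite ge_min; apply/orP; left; rewrite /block_size -sum1_card natr_sum.
by apply: ler_sum => i _; rewrite ler_nat leq_b1.
Qed.

(** [min a b = (a + b)/2 - |a - b|/2], where the difference of the two counts is the walk over the
    block. *)
Lemma block_cost_walk j t : block_cost j t =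
  (\sum_(i | blk i == j) (hit i t + hit' i t)) / 2
  - `|walk (enum [pred i | blk i == j]) t| / 2.
Proof.
rewrite /block_cost minr_absE big_split mulrBl; congr (_ - `|_| / 2).
by rewrite -sumrB /walk big_enum; apply: eq_bigl => i; rewrite inE.
Qed.

Lemma sum_block_size : \sum_j (block_size j)%:R = #|I|%:R :> R.
Proof.
rewrite -natr_sum; congr (_%:R); rewrite -sum1_card.
rewrite (partition_big blk xpredT) //=; apply: eq_bigr => j _.
by rewrite /block_size -sum1_card.
Qed.

Variable D : nat.
Hypothesis D_gt0 : (0 < D)%N.
Hypothesis blkD : forall j, (block_size j <= D)%N.

Lemma mean_block_cost j : mean (block_cost j) <=
  p / 2 * (block_size j)%:R - p / (4 * Num.sqrt D%:R) * (block_size j)%:R.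
Proof.
have us : uniq (enum [pred i | blk i == j]) by rewrite enum_uniq.
have D0 : 0 < D%:R :> R by rewrite ltr0n.
have q0 : 0 < Num.sqrt D%:R :> R by rewrite sqrtr_gt0.
have := mean_abs_walk us D0; rewrite -cardE ler_nat => /(_ (blkD j)) H.
rewrite (eq_mean (block_cost_walk j)).
have -> : mean (fun t => (\sum_(i | blk i == j) (hit i t + hit' i t)) / 2 -
      `|walk (enum [pred i | blk i == j]) t| / 2) =
    2^-1 * (\sum_(i | blk i == j) (p / 2 + p / 2)) -
    2^-1 * mean (fun t => `|walk (enum [pred i | blk i == j]) t|).
  rewrite -meanZ -meanN.
  have -> : \sum_(i | blk i == j) (p / 2 + p / 2) =
      mean (fun t => \sum_(i | blk i == j) (hit i t + hit' i t)).
    by rewrite mean_sum; apply: eq_bigr => i _; rewrite meanD mean_hit mean_hit'.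
  by rewrite -meanZ -meanD; apply: eq_mean => t; rewrite ![2^-1 * _]mulrC.
rewrite sumr_const -[in X in _ * X - _]mulr_natr.
rewrite -[#|_|]/(block_size j) in H *.
have E : p / (4 * Num.sqrt D%:R) * (block_size j)%:R =
    2^-1 * (p * (block_size j)%:R / (2 * Num.sqrt D%:R)).
  by field; rewrite gt_eqF.
by rewrite E; lra.
Qed.

(** A block cost depends only on the coordinates of its block, and distinct blocks are disjoint. *)
Lemma block_cost_indep j j' : j != j' ->
  mean (fun t => (block_cost j t - mean (block_cost j)) *
                 (block_cost j' t - mean (block_cost j'))) = 0.
Proof.
move=> ne_jj'.
have local l t t' : (forall i, blk i == l -> t i = t' i) ->
    block_cost l t = block_cost l t'.
  move=> tt'; congr Num.min; apply: eq_bigr => i /tt';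
    by rewrite /hit /hit' => ->.
rewrite (mean_indep A_gt0 (B := fun i => blk i == j)).
- by rewrite meanD (mean_const T_gt0) subrr mul0r.
- by move=> t t' tt'; rewrite (local j t t').
move=> t t' tt'; rewrite (local j' t t') // => i /eqP ij'; apply: tt'.
by rewrite ij' eq_sym.
Qed.

(** Only diagonal terms survive. A block of size [d] contributes at most [d^2 <= D d], as its cost
    and its mean both lie between 0 and [d]. *)
Lemma variance_cost :
  mean (fun t => (cost t - mean cost) ^+ 2) <= D%:R * #|I|%:R.
Proof.
have E t : (cost t - mean cost) ^+ 2 = \sum_j \sum_j'
    (block_cost j t - mean (block_cost j)) *
    (block_cost j' t - mean (block_cost j')).
  rewrite /cost mean_sum -sumrB expr2 big_distrl /=.
  by apply: eq_bigr => j _; rewrite big_distrr.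
rewrite (eq_mean E) mean_sum -sum_block_size mulr_sumr; apply: ler_sum => j _.
rewrite mean_sum (bigD1 j) //= big1 => [|j' ne_j']; last first.
  by rewrite block_cost_indep // eq_sym.
rewrite addr0 -[leRHS](mean_const (U := {: T}) T_gt0); apply: ler_mean => t.
apply: (@le_trans _ _ ((block_size j)%:R ^+ 2)); last first.
  by rewrite expr2 ler_wpM2r ?ler0n // ler_nat.
rewrite -expr2 -real_normK ?num_real // lerXn2r ?nnegrE ?ler0n //.
have m0 : 0 <= mean (block_cost j) by apply: mean_ge0; apply: block_cost_ge0.
have m1 : mean (block_cost j) <= (block_size j)%:R.
  rewrite -[leRHS](mean_const (U := {: T}) T_gt0).
  by apply: ler_mean; apply: block_cost_le.
have := block_cost_ge0 j t; have := block_cost_le j t.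
by move=> *; rewrite ler_norml; apply/andP; split; lra.
Qed.

Lemma cost_concentration : (0 < #|I|)%N ->
  mean (fun t => (p / 2 * #|I|%:R - p / 8 * #|I|%:R / Num.sqrt D%:R < cost t)%R%:R)
  <= 64 * D%:R ^+ 2 / (p ^+ 2 * #|I|%:R).
Proof.
move=> I_gt0; set q := Num.sqrt D%:R; set m := #|I|%:R.
have m0 : 0 < m by rewrite ltr0n.
have D0 : 0 < D%:R :> R by rewrite ltr0n.
have q0 : 0 < q by rewrite sqrtr_gt0.
have qD : q ^+ 2 = D%:R by rewrite sqr_sqrtr // ltW.
have p0 : 0 < p by rewrite divr_gt0 ?ltr0n.
have mean_le : mean cost <= p / 2 * m - p / (4 * q) * m.
  rewrite [mean cost]mean_sum /m -sum_block_size !mulr_sumr -sumrB.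
  by apply: ler_sum => j _; apply: mean_block_cost.
(* Half of the mean gain [p m / (4 q)]; the other half is the gain that remains. *)
pose d := p * m / (8 * q).
have d0 : 0 < d by apply: divr_gt0; apply: mulr_gt0 => //; rewrite ltr0n.
apply: (@le_trans _ _ (mean (fun t => (d < cost t - mean cost)%R%:R))).
  apply: ler_mean => t; rewrite ler_nat.
  have [lt_c|//] := ltP (p / 2 * m - p / 8 * m / q) (cost t).
  suff -> : d < cost t - mean cost by [].
  have E : p / (4 * q) * m - p / 8 * m / q = d by rewrite /d; field; rewrite gt_eqF.
  by lra.
apply: le_trans (chebyshev cost d0) _; rewrite ler_pdivrMr ?exprn_gt0 //.
apply: le_trans variance_cost _; rewrite -/m -qD.
suff -> : 64 * (q ^+ 2) ^+ 2 / (p ^+ 2 * m) * d ^+ 2 = q ^+ 2 * m by [].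
by rewrite /d; field; rewrite !gt_eqF.
Qed.

End Majority.

(** * Decoupling the signs *)

Section Violations.
Variables (pb : problem) (k : nat).
Local Notation values := {ffun 'I_k -> bool}.

(* Violation depends only on the signs relative to the values. *)
Definition twist (v : values) : signs pb k -> signs pb k :=
  match pb return signs pb k -> signs pb k with
  | MaxXOR => fun s => [ffun i => s i (+) \big[addb/false]_j v j]
  | MaxSAT => fun s => [ffun j => s j (+) v j]
  end.

(** The one sign vector violated when all the variables are 1. *)
Definition violating : signs pb k :=
  match pb return signs pb k with
  | MaxXOR => [ffun=> true]
  | MaxSAT => [ffun=> false]
  end.

Lemma violE (s : signs pb k) v : viol s v = (twist v s == violating).
Proof.
rewrite /viol /twist /violating; case: pb s => s /=.
  have -> : \prod_(j < k) pm (v (tnth (ord_tuple k) j)) =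
            pm (\big[addb/false]_j v j).
    rewrite (big_morph pm (id1 := 1) (op1 := *%R)) //; last first.
      by move=> a b; rewrite /pm signr_addb.
    by apply: eq_bigr => j _; rewrite tnth_ord_tuple.
  set b := \big[_/_]_j _.
  have -> : ([ffun i => s i (+) b] == [ffun=> true]) = s ord0 (+) b.
    apply/eqP/idP => [/ffunP/(_ ord0)|sb]; first by rewrite !ffunE.
    by apply/ffunP => i; rewrite !ffunE (ord1 i).
  by rewrite /pm; case: (s ord0) b => [] [].
have -> : \prod_(j < k) ((1 + pm (s j) * pm (v (tnth (ord_tuple k) j))) / 2) =
          [forall j, ~~ (s j (+) v j)]%:R.
  have E j : (1 + pm (s j) * pm (v (tnth (ord_tuple k) j))) / 2 =
      (~~ (s j (+) v j))%:R.
    by rewrite tnth_ord_tuple /pm; case: (s j) (v j) => [] [].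
  rewrite (eq_bigr _ (fun j _ => E j)); case: (boolP [forall j, _]).
    by move=> /forallP all0; rewrite big1 // => j _; rewrite all0.
  rewrite negb_forall => /existsP[j]; rewrite negbK => sv.
  by rewrite (bigD1 j) //= sv mul0r.
have -> : ([ffun j => s j (+) v j] == [ffun=> false]) = [forall j, ~~ (s j (+) v j)].
  apply/eqP/forallP => [/ffunP H j|H].
    by have := H j; rewrite !ffunE => ->.
  by apply/ffunP => j; rewrite !ffunE; apply/negbTE.
by case: [forall _, _].
Qed.

Lemma twistD (v u : values) (s : signs pb k) :
  twist [ffun j => v j (+) u j] s = twist v (twist u s).
Proof.
rewrite /twist; case: pb s => s; apply/ffunP => i; rewrite !ffunE.
  under eq_bigr do rewrite ffunE.
  by rewrite big_split /= -addbA [X in _ (+) X]addbC.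
by rewrite -addbA [X in _ (+) X]addbC.
Qed.

Lemma twist0 (s : signs pb k) : twist [ffun=> false] s = s.
Proof.
rewrite /twist; case: pb s => s; apply/ffunP => i; rewrite !ffunE ?addbF //.
by rewrite big1 ?addbF // => j _; rewrite ffunE.
Qed.

Lemma twistK v : involutive (twist v).
Proof.
move=> s; rewrite -twistD -[RHS]twist0; congr twist.
by apply/ffunP => j; rewrite !ffunE addbb.
Qed.

Definition at_pos (j : 'I_k) (b : bool) : values := [ffun i => (i == j) && b].

(** Hence no constraint is violated by both values of its last variable. *)
Lemma twist_at_pos j : twist (at_pos j true) violating != violating.
Proof.
rewrite /twist /violating; case: pb; apply/eqP => /ffunP.
  move=> /(_ ord0); rewrite !ffunE (bigD1 j) //= big1 => [|i /negbTE ij].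
    by rewrite ffunE eqxx.
  by rewrite ffunE ij.
by move=> /(_ j); rewrite !ffunE eqxx.
Qed.

Lemma predicate_values n (s : signs pb k) (S : k.-tuple 'I_n) (x : assignment n) :
  predicate s S x = predicate s (ord_tuple k) [ffun j => x (tnth S j)].
Proof.
rewrite /predicate; case: pb s => s.
  by congr (_ + _ * _); apply: eq_bigr => j _; rewrite ffunE tnth_ord_tuple.
by congr (_ - _); apply: eq_bigr => j _; rewrite ffunE tnth_ord_tuple.
Qed.

End Violations.

(** * The greedy run in terms of the relative signs *)

Lemma onth_greedy pb k (I : instance pb k) i a :
  onth (greedy I i) a =
  if (a < i)%N then Some (best_value I (greedy I a)) else None.
Proof.
elim: i => [|i IH] /=; first by case: a.
rewrite -cats1 onth_cat size_greedy IH ltnS.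
case: ltngtP => [//|lt_ia|->]; last by rewrite subnn.
by rewrite onth_default //= subn_gt0.
Qed.

Section Decoupling.
Variables (pb : problem) (k : nat).
Hypothesis k_gt0 : (0 < k)%N.
Variables (m n : nat) (S : 'I_m -> k.-tuple 'I_n).
Hypothesis S_uniq : forall l, uniq (S l).
Local Notation T := {ffun 'I_m -> signs pb k}.
Local Notation inst s := (Instance S (s : T)).

Definition last_pos l : 'I_k :=
  [arg max_(j > Ordinal k_gt0) (tnth (S l) j : nat)]%N.

Definition last_var l : 'I_n := tnth (S l) (last_pos l).

(** The inequality is strict because the variables of a scope are distinct; so all the others have
    their values when the last one is chosen. *)
Lemma lt_last_var l j : j != last_pos l -> (tnth (S l) j < last_var l)%N.
Proof.
rewrite /last_var /last_pos; case: arg_maxnP => // q _ max_q ne_jq.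
have le_jq : (tnth (S l) j <= tnth (S l) q)%N := max_q j isT.
rewrite ltn_neqAle le_jq andbT; apply: contra ne_jq => /eqP/val_inj.
by move/tuple_uniqP: (S_uniq l) => S_inj /S_inj ->.
Qed.

Definition greedy_assignment (s : T) : assignment n :=
  [ffun i : 'I_n => best_value (inst s) (greedy (inst s) i)].

(* The signs of a constraint relative to the values of all its variables but
   the last: the greedy choices depend on s only through these. *)
Definition relative_signs (s : T) : T :=
  [ffun l => twist [ffun j => (j != last_pos l) &&
                              greedy_assignment s (tnth (S l) j)] (s l)].

(** For [t] the relative signs of [s], the number of constraints that become violated when [x_i]
    gets the value [b]. *)
Definition ncost (t : T) (i : 'I_n) (b : bool) : nat :=
  (\sum_(l | last_var l == i)
     (twist (at_pos (last_pos l) b) (t l) == violating pb k))%N.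

Lemma pviol_future (s : T) l i : (i <= last_var l)%N ->
  pviol (s l) (prefix_values (S l) (greedy (inst s) i)) = false.
Proof.
move=> le_i; rewrite /pviol; case: forallP => // /(_ (last_pos l)).
by rewrite ffunE onth_greedy -/(last_var l) ltnNge le_i.
Qed.

Lemma pviol_past (s : T) l i b : (last_var l < i)%N ->
  pviol (s l) (prefix_values (S l) (rcons (greedy (inst s) i) b)) =
  pviol (s l) (prefix_values (S l) (greedy (inst s) i)).
Proof.
move=> lt_i; congr pviol; apply/ffunP => j; rewrite !ffunE -cats1 onth_cat.
rewrite size_greedy ifT //; apply: leq_ltn_trans lt_i.
by have [->|/lt_last_var/ltnW] := eqVneq j (last_pos l).
Qed.

(** Twists compose, so the values split into the earlier ones, absorbed in the relative signs, and
    the last one, [b]. *)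
Lemma pviol_present (s : T) l i b : last_var l = i :> nat ->
  pviol (s l) (prefix_values (S l) (rcons (greedy (inst s) i) b)) =
  (twist (at_pos (last_pos l) b) (relative_signs s l) == violating pb k).
Proof.
move=> lst; have val_j j : onth (rcons (greedy (inst s) i) b) (tnth (S l) j) =
    Some (if j == last_pos l then b else greedy_assignment s (tnth (S l) j)).
  rewrite -cats1 onth_cat size_greedy onth_greedy ffunE.
  have [->|/lt_last_var] := eqVneq j (last_pos l).
    by rewrite -/(last_var l) lst ltnn subnn.
  by rewrite lst => ->.
rewrite /pviol; case: forallP => [_|[]]; last by move=> j; rewrite ffunE val_j.
rewrite violE /relative_signs ffunE -twistD; congr (twist _ _ == _).
apply/ffunP => j; rewrite !ffunE val_j /=.
by case: eqP => _ /=; rewrite ?addbF ?ffunE.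
Qed.

(** Constraints with an earlier last variable keep their status and those with a later one are not
    counted yet, so only those ending at [i] are new. *)
Lemma nviol_rcons (s : T) (i : 'I_n) b :
  nviol (inst s) (rcons (greedy (inst s) i) b) =
  (nviol (inst s) (greedy (inst s) i) + ncost (relative_signs s) i b)%N.
Proof.
have countE xs : nviol (inst s) xs =
    (\sum_l pviol (s l) (prefix_values (S l) xs))%N.
  rewrite /nviol -sum1_count big_enum_cond /= big_mkcond /=.
  by apply: eq_bigr => l _; case: ifP.
rewrite !countE /ncost [X in (_ + X)%N]big_mkcond -big_split /=.
apply: eq_bigr => l _; have [il|ne_il] := eqVneq (last_var l) i.
  by rewrite (pviol_future s (l := l)) ?il // pviol_present ?il.
rewrite addn0; have [lt_i|] := ltnP (last_var l) i; first by rewrite pviol_past.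
rewrite leq_eqVlt eq_sym val_eqE (negbTE ne_il) /= => lt_i.
rewrite -[rcons _ b]/(rcons (greedy (inst s) i) b) (pviol_future s (l := l)) 1?ltnW //.
rewrite /pviol; case: forallP => // /(_ (last_pos l)).
rewrite ffunE onth_default // size_rcons size_greedy -/(last_var l).
by rewrite lt_i.
Qed.

Lemma greedy_assignmentE (s : T) i : greedy_assignment s i =
  (ncost (relative_signs s) i true < ncost (relative_signs s) i false)%N.
Proof. by rewrite ffunE /best_value !nviol_rcons ltn_add2l. Qed.

(** The relative signs determine the greedy values, and for fixed values each twist is an
    involution. *)
Lemma relative_signs_inj : injective relative_signs.
Proof.
move=> s t st; have xst : greedy_assignment s = greedy_assignment t.
  by apply/ffunP => i; rewrite !greedy_assignmentE st.
apply/ffunP => l; move/ffunP/(_ l): st; rewrite !ffunE xst.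
exact: (inv_inj (twistK _)).
Qed.

Lemma nviol_greedy (s : T) : nviol (inst s) (greedy (inst s) n) =
  (\sum_(i < n) minn (ncost (relative_signs s) i false)
                     (ncost (relative_signs s) i true))%N.
Proof.
have H j : (j <= n)%N -> nviol (inst s) (greedy (inst s) j) =
    (\sum_(i < n | i < j) minn (ncost (relative_signs s) i false)
                               (ncost (relative_signs s) i true))%N.
  elim: j => [_|j IH lt_jn].
    rewrite big_pred0 // /nviol (eq_count (a2 := pred0)) ?count_pred0 // => l.
    rewrite /pviol; case: forallP => // /(_ (Ordinal k_gt0)).
    by rewrite ffunE onth_default.
  rewrite (bigD1 (Ordinal lt_jn)) //= addnC.
  have := nviol_rcons s (Ordinal lt_jn) (best_value (inst s) (greedy (inst s) j)).
  rewrite /= => ->; congr addn.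
    rewrite IH 1?ltnW //; apply: eq_bigl => i.
    by rewrite ltnS -val_eqE /= [RHS]andbC ltn_neqAle.
  have := greedy_assignmentE s (Ordinal lt_jn); rewrite ffunE /= => ->.
  by rewrite minnC /minn; case: ltnP.
by rewrite H //; apply: eq_bigl => i; rewrite ltn_ord.
Qed.

Lemma pviol_greedy (s : T) l :
  pviol (s l) (prefix_values (S l) (greedy (inst s) n)) =
  (predicate (s l) (S l) (greedy_assignment s) != 1).
Proof.
rewrite predicate_values /pviol; case: forallP => [_|[]]; last first.
  by move=> j; rewrite ffunE onth_greedy ltn_ord.
rewrite /viol; congr (predicate _ _ _ != _).
by apply/ffunP => j; rewrite !ffunE onth_greedy ltn_ord.
Qed.

Lemma sat_fraction_greedy (R : realType) (s : T) : (0 < m)%N ->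
  sat_fraction R (inst s) (greedy_assignment s) =
  1 - (nviol (inst s) (greedy (inst s) n))%:R / m%:R.
Proof.
move=> m_gt0; rewrite /sat_fraction /=.
set A := [set l | _].
have -> : nviol (inst s) (greedy (inst s) n) = #|~: A|.
  rewrite /nviol cardE -size_filter /= /enum_mem -filter_predI.
  congr size; apply: eq_filter => l.
  by rewrite /= !inE pviol_greedy andbT.
have m0 : m%:R != 0 :> R by rewrite pnatr_eq0 -lt0n.
have E : #|A|%:R + #|~: A|%:R = m%:R :> R by rewrite -natrD cardsC card_ord.
have -> : #|A|%:R = m%:R - #|~: A|%:R :> R by rewrite -E addrK.
by rewrite mulrBl divff.
Qed.

(** The value [false] twists trivially, so [hit] and [hit'] are the violations by [false] and by
    [true]. *)
Lemma cost_relative_signs (R : rcfType) (s : T) :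
  (nviol (inst s) (greedy (inst s) n))%:R =
  cost R (violating pb k) (fun l => twist (at_pos (last_pos l) true)) last_var
    (relative_signs s).
Proof.
rewrite nviol_greedy natr_sum; apply: eq_bigr => i _.
rewrite /block_cost natr_min /ncost !natr_sum.
congr Num.min; apply: eq_bigr => l _ //.
rewrite /hit; congr (_ == _)%:R; rewrite -[RHS]twist0; congr twist.
by apply/ffunP => j; rewrite !ffunE andbF.
Qed.

End Decoupling.

(** * The quantum algorithm and its success probability *)

Lemma flip_circuit_greedy_word pb k (I : instance pb k) :
  circuit_word (flip_circuit
    [ffun i : 'I_(nvars I) => best_value I (greedy I i)]) = output_word I.
Proof. by apply: flip_circuit_word => i; rewrite ffunE. Qed.

Definition greedy_machine pb k : machine := machine_of (reg0 pb k) (main pb k).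

Lemma greedy_machine_poly pb k : (0 < k)%N ->
  poly_time_quantum_algorithm pb k (greedy_machine pb k).
Proof.
move=> k_gt0; exists 200%N, 2%N => I w.
have [t le_t run_t] := main_computes k_gt0 I.
exists 0%N, (flip_circuit [ffun i : 'I_(nvars I) => best_value I (greedy I i)]), t.
by split=> //; rewrite flip_circuit_greedy_word.
Qed.

Lemma greedy_machine_finds (R : realType) pb k (I : instance pb k)
    (P : pred (assignment (nvars I))) : (0 < k)%N ->
  P [ffun i : 'I_(nvars I) => best_value I (greedy I i)] ->
  finds R (greedy_machine pb k) I P.
Proof.
move=> k_gt0 Px; have [t _ run_t] := main_computes k_gt0 I.
exists 0%N, (flip_circuit [ffun i : 'I_(nvars I) => best_value I (greedy I i)]), t.
split; first by rewrite flip_circuit_greedy_word.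
rewrite measure_flip_circuit // ler_pdivrMr ?ltr0n // mul1r.
by rewrite ler_nat.
Qed.

Lemma unif_probE (R : realType) (U : finType) (E : U -> Prop) :
  unif_prob R E = mean (fun u => `[< E u >]%:R : R).
Proof.
rewrite /unif_prob /mean -sum1_card natr_sum big_mkcond /=.
by congr (_ / _); apply: eq_bigr => u _; rewrite inE; case: ifP.
Qed.

(** Written so that [1 - mu] is [p / 2] for the [p] of the concentration bound. *)
Lemma muE (R : realType) pb k : mu R pb k = 1 - 2 / #|{: signs pb k}|%:R / 2.
Proof.
rewrite card_ffun card_bool card_ord natrX.
have E : (2 / 2 ^+ nsigns pb k / 2 : R) = 2 ^- nsigns pb k.
  by rewrite mulrAC divff ?pnatr_eq0 // mul1r.
by rewrite E; case: pb {E} => //=; rewrite expr1; lra.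
Qed.

Theorem corollary5 (R : realType) (k : nat) (hk : (1 <= k)%N) :
  exists c C : R, 0 < c /\ 0 < C /\
  forall pb : problem,
  exists M : machine, poly_time_quantum_algorithm pb k M /\
  forall (D m n : nat), (1 <= D)%N -> (1 <= m)%N -> (1 <= n)%N ->
  forall S : 'I_m -> k.-tuple 'I_n,
    (forall l, uniq (S l)) ->
    injective (fun l => [set i in S l]) ->
    (forall i : 'I_n, (#|[set l | i \in S l]| <= D)%N) ->
    1 - C * D%:R ^+ 3 / m%:R <=
      unif_prob R (fun s : {ffun 'I_m -> signs pb k} =>
        finds R M (Instance S s)
          [pred x | mu R pb k + c / Num.sqrt D%:R
                      <= sat_fraction R (Instance S s) x]).
Proof.
(* A lower bound for [p] in both problems, as a constraint has at most [k] signs. *)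
pose r : R := 2 / 2 ^+ k.
have r0 : 0 < r by rewrite divr_gt0 ?exprn_gt0 ?ltr0n.
(* The gain [p / 8] and the factor [64 / p^2] of the concentration bound, with [r] for [p]. *)
exists (r / 8), (64 / r ^+ 2).
split; [by rewrite divr_gt0|split; [by rewrite divr_gt0 ?exprn_gt0|move=> pb]].
exists (greedy_machine pb k); split; first exact: greedy_machine_poly.
move=> D m n D_gt0 m_gt0 _ S S_uniq _ S_deg.
pose lv := last_var hk S.
pose sigma l := twist (pb := pb) (at_pos (last_pos hk S l) true).
pose w : {ffun 'I_m -> signs pb k} -> R := cost R (violating pb k) sigma lv.
pose p : R := 2 / #|{: signs pb k}|%:R.
have le_rp : r <= p.
  rewrite /r /p card_ffun card_bool card_ord natrX.
  rewrite ler_wpM2l ?ler0n // lef_pV2 ?posrE ?exprn_gt0 ?ltr0n //.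
  by rewrite ler_eXn2l ?ltr1n //; case: (pb).
have p0 : 0 < p := lt_le_trans r0 le_rp.
have m0 : 0 < m%:R :> R by rewrite ltr0n.
have D0 : 0 < D%:R :> R by rewrite ltr0n.
have q0 : 0 < Num.sqrt D%:R :> R by rewrite sqrtr_gt0.
have lvD i : (block_size lv i <= D)%N.
  apply: leq_trans (S_deg i); apply/subset_leq_card/subsetP => l.
  by rewrite !inE => /eqP <-; apply: mem_tnth.
have := @cost_concentration R _ _ _ (violating pb k) sigma lv
  (fun l => twistK _) (fun l => twist_at_pos pb (last_pos hk S l)) D D_gt0 lvD.
rewrite card_ord -/p => /(_ m_gt0).
(* The relative signs of uniform signs are uniform, so the bound passes to the greedy run. *)
rewrite -(mean_reindex _ (@relative_signs_inj pb k hk m n S S_uniq)) => bad_le.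
have T_gt0 : (0 < #|{: {ffun 'I_m -> signs pb k}}|)%N.
  by apply/card_gt0P; exists [ffun=> violating pb k].
(* Here [r <= p] and [D^2 <= D^3] are used. *)
apply: le_trans (_ : 1 - 64 * D%:R ^+ 2 / (p ^+ 2 * m%:R) <= _).
  have D1 : 1 <= D%:R :> R by rewrite ler1n.
  rewrite lerB // invfM mulrA ler_wpM2r ?invr_ge0 ?(ltW m0) //.
  rewrite mulrAC ler_pM ?divr_ge0 ?exprn_ge0 ?ler0n ?(ltW p0) //.
    rewrite ler_wpM2l ?ler0n // lef_pV2; try exact: exprn_gt0.
    by apply: lerXn2r => //; apply: ltW.
  by rewrite ler_weXn2l.
rewrite unif_probE; apply: le_trans (lerB (lexx 1) bad_le) _.
(* Pointwise comparison: success may fail only where the cost is large. *)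
rewrite -{1}(mean_const T_gt0 (1 : R)) -meanN -meanD; apply: ler_mean => s /=.
rewrite -/w; case: ltP => [_|le_w]; first by rewrite subrr ler0n.
rewrite subr0; suff -> : `[< finds R (greedy_machine pb k) (Instance S s)
   [pred x | mu R pb k + r / 8 / Num.sqrt D%:R <= sat_fraction R (Instance S s) x] >]
   = true by [].
apply/asboolP/greedy_machine_finds => //.
rewrite /= -/(greedy_assignment S s) sat_fraction_greedy //.
rewrite (@cost_relative_signs _ _ hk _ _ _ S_uniq) -/sigma -/lv -/w muE -/p.
have w_le : w (relative_signs hk S s) / m%:R <= p / 2 - p / 8 / Num.sqrt D%:R.
  rewrite ler_pdivrMr // mulrBl; apply: le_trans le_w _.
  by rewrite [p / 8 / _ * _]mulrAC.
have : r / 8 / Num.sqrt D%:R <= p / 8 / Num.sqrt D%:R.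
  by rewrite ler_wpM2r ?invr_ge0 ?(ltW q0) // ler_wpM2r ?invr_ge0 ?ler0n.
by lra.
Qed.
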